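(* Let $d\ge1$ and $q\in[1,+\infty)$. There exists a constant $c_{d,q}>1$ such that the following holds. Assume that: (a) there exists an integer $m_0\ge1$ such that $\mathbb{E}\left[\min_{1\le j\le m_0}|X'_j|\right]<+\infty$; (b) there exists an open set $U\subset\mathbb{R}^d$ containing $\operatorname{supp}(\mu_X)$ such that: (i) the measure $\mu_{X'}(\cdot\cap U)$ has a density $p_{X'}$ with respect to the Lebesgue measure; (ii) $p_{X'}$ is continuous and positive on $U$; (iii) there exist $\kappa\in(0,1]$ and $r_\kappa>0$ such that for any $x\in U$ and any $r\in[0,r_\kappa]$, $\mu_{X'}(B(x,r))\ge\kappa\,p_{X'}(x)\,v_d\,r^d$; (c) with $X\sim\mu_X$, $\mathbb{E}\left[\dfrac{1+|X|^q}{p_{X'}(X)^{q/d}}\right]<+\infty$. Then for any nondecreasing sequence of positive integers $(k_m)_{m\ge1}$ with $k_m\le m$ such that $k_m/m\to0$ when $m\to+\infty$, and every $n\ge1$, $$\limsup_{m\to+\infty}\left(\frac{m}{k_m}\right)^{q/d}\mathbb{E}\left[W_q^q\left(\hat{\mu}_{\mathbf{X}_n},\hat{\mu}_{\mathbf{X}'_m}^{(k_m)}\right)\right]\le c_{d,q}\,\frac{\Gamma(1+q/d)}{v_d^{q/d}}\,\mathbb{E}\left[\frac{1}{p_{X'}(X)^{q/d}}\right].$$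
   Context: $|\cdot|$ is a fixed norm on $\mathbb{R}^d$ (not necessarily Euclidean), $B(x,r)=\{x':|x-x'|\le r\}$, $v_d$ is the Lebesgue volume of the unit ball of $|\cdot|$, and $\Gamma$ is Euler's Gamma function. $\mu_X,\mu_{X'}$ are probability measures on $\mathbb{R}^d$. $(X_i)_{i\ge1}$ are i.i.d. with law $\mu_X$, $(X'_j)_{j\ge1}$ are i.i.d. with law $\mu_{X'}$, and the two samples are independent; $\mathbf{X}_n=(X_1,\dots,X_n)$, $\mathbf{X}'_m=(X'_1,\dots,X'_m)$. $\operatorname{supp}(\nu)=\{x\in\mathbb{R}^d:\forall r>0,\ \nu(B(x,r))>0\}$. $W_q(\mu,\nu)=\inf\{\int|x-x'|^q\,d\gamma(x,x'):\gamma\in\Pi(\mu,\nu)\}^{1/q}$, where $\Pi(\mu,\nu)$ is the set of couplings of $\mu$ and $\nu$. For $x\in\mathbb{R}^d$, order the indices $1,\dots,m$ by increasing distance $|x-X'_j|$, ties broken by lowest index, and let $j^{(l)}(x)$ be the $l$-th index in this order. Set $\hat{\mu}_{\mathbf{X}_n}:=\frac1n\sum_{i=1}^n\delta_{X_i}$ and, for $k\in\{1,\dots,m\}$, $$\hat{\mu}_{\mathbf{X}'_m}^{(k)}:=\frac1m\sum_{j=1}^m w^{(k)}_j\delta_{X'_j},\qquad w^{(k)}_j:=\frac{m}{kn}\sum_{i=1}^n\sum_{l=1}^k\mathbf{1}_{\{j=j^{(l)}(X_i)\}}$$ (this measure also depends on $\mathbf{X}_n$). *)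

(* Defs.v *)
From HB Require Import structures.
From mathcomp Require Import all_boot all_order all_algebra.
From mathcomp Require Import all_classical all_reals all_analysis.
From mathcomp Require Import measurable_realfun.

Set Implicit Arguments.
Unset Strict Implicit.
Unset Printing Implicit Defensive.

Import Order.TTheory GRing.Theory Num.Theory.
Import numFieldNormedType.Exports.

Local Open Scope classical_set_scope.
Local Open Scope ring_scope.

(** R^d is ['rV[R]_d], with the Borel sigma-algebra of its usual topology. *)

Definition rV_display : measure_display.
Proof. exact: default_measure_display. Qed.

Section borel_rV.
Context (R : realType) (d : nat).

Definition borel_rV : set (set 'rV[R]_d) := <<s open >>.

Let borel_rV0 : borel_rV set0.
Proof. exact: sigma_algebra0. Qed.

Let borel_rVC A : borel_rV A -> borel_rV (~` A).
Proof. exact: sigma_algebraC. Qed.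

Let borel_rV_bigcup (F : (set 'rV[R]_d)^nat) :
  (forall i, borel_rV (F i)) -> borel_rV (\bigcup_i F i).
Proof. exact: sigma_algebra_bigcup. Qed.

HB.instance Definition _ := @isMeasurable.Build rV_display 'rV[R]_d
  borel_rV borel_rV0 borel_rVC borel_rV_bigcup.

End borel_rV.

Section measurable_rV.
Context (R : realType).

Lemma open_measurable_rV d (U : set 'rV[R]_d) : open U -> measurable U.
Proof. by move=> oU; exact: sub_sigma_algebra. Qed.

Lemma open_rV_rational_boxes d (U : set 'rV[R]_d) : open U ->
  U = \bigcup_(qe in [set qe : 'rV[rat]_d * rat |
                       ball (map_mx ratr qe.1 : 'rV[R]_d) (ratr qe.2) `<=` U])
        ball (map_mx ratr qe.1 : 'rV[R]_d) (ratr qe.2).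
Proof.
move=> oU; apply/seteqP; split=> [x Ux|x [qe qeU]]; last exact: qeU.
have /nbhs_ballP[e /= e0 xeU] : nbhs x U by exact: open_nbhs_nbhs.
have [r /andP[r0 re]] : exists r : rat, (0 < ratr r :> R) && (ratr r < e / 2 :> R).
  have e20 : 0 < e / 2 by rewrite divr_gt0.
  have [r] := rat_in_itvoo e20.
  by rewrite in_itv/= => h; exists r.
have H (i : 'I_d) : exists s : rat, `|x ord0 i - ratr s| < ratr r.
  have h : x ord0 i - ratr r < x ord0 i + ratr r by rewrite ltrBlDr -addrA ltrDl addr_gt0.
  have [s] := rat_in_itvoo h.
  by rewrite in_itv/= => hs; exists s; rewrite distrC ltr_distl.
have [s Hs] := choice H.
have bx : ball (map_mx ratr (\row_i s i) : 'rV[R]_d) (ratr r) x.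
  split=> // i j; rewrite !mxE (ord1 i) /ball/= distrC; exact: Hs.
exists (\row_i s i, r) => //= y.
move=> ys; apply: xeU; rewrite (splitr e).
apply: (@ball_triangle _ _ (map_mx ratr (\row_i s i) : 'rV[R]_d)).
  by apply/ball_sym; apply: le_ball bx; exact: ltW.
by apply: le_ball ys; exact: ltW.
Qed.

Lemma measurable_fun_rV d disp (T : measurableType disp) (f : T -> 'rV[R]_d) :
  (forall i, measurable_fun setT (fun t => f t ord0 i)) -> measurable_fun setT f.
Proof.
move=> mf; apply: (@measurability _ _ _ _ setT f open) => //.
move=> _ [U oU <-]; rewrite (open_rV_rational_boxes oU) preimage_bigcup setTI.
rewrite bigcup_mkcond; apply: countable_bigcupT_measurable; first exact: countableP.
move=> qe; case: ifP => // _; move: qe.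
case=> q e /=.
have [e0|e0] := ltP 0 (ratr e : R); last first.
  rewrite (_ : ball _ _ = set0) ?preimage_set0//.
  by apply/seteqP; split=> // x [e0']; rewrite ltNge e0 in e0'.
rewrite (_ : _ @^-1` _ = \bigcap_(i in [set: 'I_d])
    ((fun t => f t ord0 i) @^-1` ball (ratr (q ord0 i) : R) (ratr e))).
  apply: fin_bigcap_measurable => // i _; rewrite -[X in measurable X]setTI.
  by apply: mf => //; rewrite ball_itv; exact: measurable_itv.
apply/seteqP; split=> [t [_ ft] i _|t ft].
  by have := ft ord0 i; rewrite mxE.
by split=> // i j; rewrite (ord1 i) mxE; exact: ft.
Qed.

Lemma measurable_coord d (i : 'I_d) :
  measurable_fun setT (fun v : 'rV[R]_d => v ord0 i).
Proof.
apply: (measurability _ (@RGenOpens.measurableE R)) => // _ [_ [a [b ->]] <-].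
rewrite setTI; apply: open_measurable_rV; apply: open_comp; last exact: interval_open.
by move=> v _; exact: coord_continuous.
Qed.

Lemma measurable_box d (a b : 'rV[R]_d) :
  measurable [set v : 'rV[R]_d | forall i, a ord0 i <= v ord0 i <= b ord0 i].
Proof.
rewrite (_ : mkset _ = \bigcap_(i in [set: 'I_d])
    ((fun v : 'rV[R]_d => v ord0 i) @^-1` `[a ord0 i, b ord0 i]%classic)).
  apply: fin_bigcap_measurable => // i _; rewrite -[X in measurable X]setTI.
  by apply: measurable_coord => //; exact: measurable_itv.
apply/seteqP; split=> [v H i _|v H i] /=; first by rewrite in_itv; exact: H.
by have := H i Logic.I; rewrite /= in_itv.
Qed.

End measurable_rV.

Section lebesgue_rV.
Context (R : realType).

Definition cons_rV d (xv : R * 'rV[R]_d) : 'rV[R]_d.+1 :=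
  \row_i if unlift ord0 i is Some j then xv.2 ord0 j else xv.1.

Lemma measurable_cons_rV d : measurable_fun setT (@cons_rV d).
Proof.
apply: measurable_fun_rV => i; case: (unliftP ord0 i) => [j|] ->.
  apply: (eq_measurable_fun ((fun v : 'rV[R]_d => v ord0 j) \o snd)).
    by move=> xv _ /=; rewrite mxE liftK.
  by apply: measurableT_comp => //; exact: measurable_coord.
apply: (eq_measurable_fun fst) => //.
by move=> xv _ /=; rewrite mxE unlift_none.
Qed.

Definition uncons_rV d (v : 'rV[R]_d.+1) : R * 'rV[R]_d :=
  (v ord0 ord0, \row_j v ord0 (lift ord0 j)).

Lemma measurable_uncons_rV d : measurable_fun setT (@uncons_rV d).
Proof.
apply: measurable_fun_pair; first exact: measurable_coord.
apply: measurable_fun_rV => j.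
apply: (eq_measurable_fun (fun v : 'rV[R]_d.+1 => v ord0 (lift ord0 j))).
  by move=> v _; rewrite mxE.
exact: measurable_coord.
Qed.

Lemma cons_rVK d : cancel (@cons_rV d) (@uncons_rV d).
Proof.
move=> [x v]; rewrite /uncons_rV mxE unlift_none; congr (_, _).
by apply/rowP => j; rewrite !mxE liftK.
Qed.

(** d-dimensional Lebesgue measure, as an iterated product. *)
Fixpoint lebesgue_rV d : set 'rV[R]_d -> \bar R :=
  match d with
  | 0 => dirac (0 : 'rV[R]_0)
  | d'.+1 => pushforward (lebesgue_measure \x @lebesgue_rV d')%E (@cons_rV d')
  end.

Lemma sigma_finite_measure_of disp (T : measurableType disp)
    (nu : set T -> \bar R) :
  nu set0 = 0%E -> (forall A, 0 <= nu A)%E -> semi_sigma_additive nu ->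
  sigma_finite setT nu ->
  exists mu : {sigma_finite_measure set T -> \bar R}, nu = mu.
Proof.
move=> nu0 nu_ge0 nu_sigma nu_sfin.
pose H1 := isMeasure.Build _ _ _ nu nu0 nu_ge0 nu_sigma.
pose m : {measure set T -> \bar R} := HB.pack nu H1.
pose H2 := Measure_isSigmaFinite.Build _ _ _ m nu_sfin.
by exists (HB.pack_for {sigma_finite_measure set T -> \bar R} nu H1 H2).
Qed.

Lemma lebesgue_rV_measure d :
  exists mu : {sigma_finite_measure set 'rV[R]_d -> \bar R},
    lebesgue_rV (d := d) = mu.
Proof.
elim: d => [|d [mu IH]]; first by exists (dirac (0 : 'rV[R]_0)).
pose pr : {measure set (measurableTypeR R * 'rV[R]_d)%type -> \bar R} :=
  (@lebesgue_measure R \x mu)%E.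
pose nu : set 'rV[R]_d.+1 -> \bar R := pushforward pr (@cons_rV d).
have mcons A : measurable A -> measurable (@cons_rV d @^-1` A).
  by move=> mA; rewrite -[X in measurable X]setTI; exact: measurable_cons_rV.
have nu0 : (nu set0 = 0)%E by rewrite /nu /pushforward preimage_set0 (measure0 pr).
have nu_ge0 A : (0 <= nu A)%E by exact: (measure_ge0 pr).
have nu_sigma : semi_sigma_additive nu.
  move=> F mF tF mUF; rewrite /nu /pushforward preimage_bigcup.
  apply: (measure_semi_sigma_additive (s := pr)) => [n||].
  - exact: mcons.
  - apply/trivIsetP => /= i j _ _ ij; rewrite -preimage_setI.
    by move/trivIsetP : tF => /(_ _ _ _ _ ij) ->//; rewrite preimage_set0.
  - by rewrite -preimage_bigcup; exact: mcons.
have nu_sfin : sigma_finite setT nu.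
  have /sigma_finiteP[F [FT ndF Foo]] := sigma_finiteT (@lebesgue_measure R).
  have /sigma_finiteP[G [GT ndG Goo]] := sigma_finiteT mu.
  exists (fun n => @uncons_rV d @^-1` (F n `*` G n)).
    apply/seteqP; split=> // v _.
    have [i _ Fi] : (\bigcup_i F i) (uncons_rV v).1 by rewrite -FT.
    have [j _ Gj] : (\bigcup_i G i) (uncons_rV v).2 by rewrite -GT.
    exists (maxn i j) => //; split => /=.
      by move: Fi; exact/subsetPset/ndF/leq_maxl.
    by move: Gj; exact/subsetPset/ndG/leq_maxr.
  move=> n; have [mF Fn] := Foo n; have [mG Gn] := Goo n; split.
    rewrite -[X in measurable X]setTI; apply: measurable_uncons_rV => //.
    exact: measurableX.
  rewrite /nu /pushforward -comp_preimage (_ : _ \o _ = id).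
    by rewrite /pr/= product_measure1E// lte_mul_pinfty// ge0_fin_numE.
  by apply/funext => xv; exact: cons_rVK.
have [m nuE] := sigma_finite_measure_of nu0 nu_ge0 nu_sigma nu_sfin.
by exists m; rewrite -nuE /= IH.
Qed.

Section lebesgue_rV_instance.
Context (d : nat).
Local Notation leb := (@lebesgue_rV d).

Let lebesgue_rV0 : leb set0 = 0%E.
Proof. by have [mu ->] := lebesgue_rV_measure d. Qed.

Let lebesgue_rV_ge0 A : (0 <= leb A)%E.
Proof. by have [mu ->] := lebesgue_rV_measure d. Qed.

Let lebesgue_rV_sigma_additive : semi_sigma_additive leb.
Proof.
by have [mu ->] := lebesgue_rV_measure d; exact: measure_semi_sigma_additive.
Qed.

Let lebesgue_rV_sigma_finite : sigma_finite setT leb.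
Proof. by have [mu ->] := lebesgue_rV_measure d; exact: sigma_finiteT. Qed.

HB.instance Definition _ := isMeasure.Build _ _ _ leb
  lebesgue_rV0 lebesgue_rV_ge0 lebesgue_rV_sigma_additive.

HB.instance Definition _ := Measure_isSigmaFinite.Build _ _ _ leb
  lebesgue_rV_sigma_finite.

End lebesgue_rV_instance.

Lemma lebesgue_rV_box d (a b : 'rV[R]_d) : (forall i, a ord0 i <= b ord0 i) ->
  lebesgue_rV [set v | forall i, a ord0 i <= v ord0 i <= b ord0 i] =
  (\prod_i (b ord0 i - a ord0 i))%:E.
Proof.
elim: d a b => [|d IH] a b ab.
  rewrite /= big_ord0 diracE mem_set//; first by case.
rewrite /= /pushforward.
rewrite (_ : _ @^-1` _ = `[a ord0 ord0, b ord0 ord0]%classic `*`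
    [set v : 'rV[R]_d | forall i, (uncons_rV a).2 ord0 i <= v ord0 i <=
                                  (uncons_rV b).2 ord0 i]).
  have /IH IHab i : (uncons_rV a).2 ord0 i <= (uncons_rV b).2 ord0 i.
    by rewrite !mxE.
  rewrite product_measure1E//; last exact: measurable_box.
  transitivity (lebesgue_measure `[a ord0 ord0, b ord0 ord0]%classic *
    (\prod_i ((uncons_rV b).2 ord0 i - (uncons_rV a).2 ord0 i))%:E)%E.
    by congr (_ * _)%E; exact: IHab.
  rewrite lebesgue_measure_itv/= lte_fin big_ord_recl EFinM; congr (_ * _)%E.
    have [ab0|ba0] := ltP (a ord0 ord0) (b ord0 ord0); first by rewrite EFinB.
    have -> : b ord0 ord0 = a ord0 ord0 by apply/le_anti; rewrite ba0 ab.
    by rewrite subrr.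
  by congr EFin; apply: eq_bigr => i _; rewrite !mxE.
apply/seteqP; split=> [[x v] /= H|[x v] /= [xab H] i].
  split.
    by have := H ord0; rewrite mxE unlift_none in_itv.
  by move=> i; have := H (lift ord0 i); rewrite !mxE liftK.
rewrite mxE; case: unliftP => [j|] ->; last by rewrite in_itv in xab.
by have := H j; rewrite !mxE.
Qed.

End lebesgue_rV.

Section geometry.
Context (R : realType) (d : nat).

Record is_norm (N : 'rV[R]_d -> R) : Prop := IsNorm {
  is_norm_triangle : forall x y, N (x + y) <= N x + N y ;
  is_norm_scale : forall (a : R) x, N (a *: x) = `|a| * N x ;
  is_norm_eq0 : forall x, N x = 0 -> x = 0 }.

Variable N : 'rV[R]_d -> R.

Definition norm_ball (x : 'rV[R]_d) (r : R) : set 'rV[R]_d :=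
  [set y | N (x - y) <= r].

Definition unit_ball_volume : R := fine (lebesgue_rV (norm_ball 0 1)).

Definition msupport (mu : set 'rV[R]_d -> \bar R) : set 'rV[R]_d :=
  [set x | forall r : R, 0 < r -> (0 < mu (norm_ball x r))%E].

Definition density_on (mu : set 'rV[R]_d -> \bar R) (U : set 'rV[R]_d)
    (p : 'rV[R]_d -> R) : Prop :=
  [/\ measurable_fun setT p,
      forall x, 0 <= p x &
      forall A, measurable A ->
        mu (A `&` U) = (\int[@lebesgue_rV R d]_(x in A) (p x)%:E)%E].

Definition couplings (mu nu : set 'rV[R]_d -> \bar R) :
    set (probability ('rV[R]_d * 'rV[R]_d)%type R) :=
  [set gamma | forall A, measurable A ->
     gamma (A `*` setT) = mu A /\ gamma (setT `*` A) = nu A].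

Definition wasserstein (q : R) (mu nu : set 'rV[R]_d -> \bar R) : \bar R :=
  (ereal_inf [set (\int[gamma]_z (N (z.1 - z.2) `^ q)%:E)%E |
              gamma in couplings mu nu] `^ q^-1)%E.

End geometry.

Section nearest_neighbours.
Context (R : realType) (d : nat) (N : 'rV[R]_d -> R).

(** Samples are indexed from 0: the points are [x' 0, ..., x' m.-1], and
    [nn_index m x' x l] is the index of the (l+1)-th nearest neighbour of [x]
    among them. *)
Definition nn_index (m : nat) (x' : nat -> 'rV[R]_d) (x : 'rV[R]_d) (l : nat)
    : nat :=
  nth 0%N (sort (fun i j => (N (x - x' i) < N (x - x' j)) ||
                            ((N (x - x' i) == N (x - x' j)) && (i <= j)%N))
                (iota 0 m)) l.

Definition nn_weight (k n m : nat) (x x' : nat -> 'rV[R]_d) (j : nat) : R :=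
  m%:R / (k%:R * n%:R) *
  \sum_(i < n) \sum_(l < k) (j == nn_index m x' (x i) l)%:R.

Definition empirical_measure (n : nat) (x : nat -> 'rV[R]_d)
    (A : set 'rV[R]_d) : \bar R :=
  ((n%:R^-1)%:E * \sum_(i < n) \d_(x i) A)%E.

Definition nn_measure (k n m : nat) (x x' : nat -> 'rV[R]_d)
    (A : set 'rV[R]_d) : \bar R :=
  ((m%:R^-1)%:E * \sum_(j < m) (nn_weight k n m x x' j)%:E * \d_(x' j) A)%E.

End nearest_neighbours.

Section independence.
Context disp disp' (Omega : measurableType disp) (T : measurableType disp')
  (R : realType) (P : probability Omega R).

Definition mutually_independent (X : nat -> {RV P >-> T}) : Prop :=
  forall (s : seq nat) (A : nat -> set T), uniq s ->
    (forall i, measurable (A i)) ->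
    P (\big[setI/setT]_(i <- s) (X i @^-1` A i)) =
    (\prod_(i <- s) P (X i @^-1` A i))%E.

Definition iid (X : nat -> {RV P >-> T}) (mu : set T -> \bar R) : Prop :=
  mutually_independent X /\
  forall i A, measurable A -> distribution P (X i) A = mu A.

Definition sigma_of (X : nat -> {RV P >-> T}) : set (set Omega) :=
  <<s \bigcup_i preimage_set_system setT (X i) measurable >>.

Definition independent_samples (X X' : nat -> {RV P >-> T}) : Prop :=
  forall A B, sigma_of X A -> sigma_of X' B -> P (A `&` B) = (P A * P B)%E.

End independence.

Definition Gamma {R : realType} (s : R) : R :=
  \int[@lebesgue_measure R]_(t in `]0, +oo[) (t `^ (s - 1) * expR (- t)).

(* Main.v *)
(** Proof idea.  Sending every [X_i] uniformly to its [k] nearest neighbours is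
    a coupling, so the expected cost is at most the integral against [mu_X] of
    [E (D_k(x) ^ q)], where [D_k(x)] is the distance from [x] to its [k]-th
    nearest neighbour among the [X'_j].  With [F] the [mu_X']-mass of the ball
    [B(x, r)], the event [D_k(x) > r] says that a binomial [(m, F)] variable is
    less than [k], so an exponential Markov inequality gives
    [P (D_k(x) > r) <= e * exp (- (m / k) * F / 4)], and moment hypothesis (a)
    gives a polynomial tail in [r] times [e ^ - m] for large [r].  Summing these
    over dyadic radii starting at [s], with [s ^ d = k / (m * p(x) * v_d)], bounds
    [(m / k) ^ (q / d) * E (D_k(x) ^ q)] in two ways: continuity of [p] at [x]
    gives [C_(d,q) / (p(x) * v_d) ^ (q / d)] for [m] large depending on [x], with
    a constant free of [kappa], and (b)(iii) gives a [mu_X]-integrable majorant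
    valid for all [x]; dominated convergence concludes. *)

Require Import Defs.
From HB Require Import structures.
From mathcomp Require Import all_boot all_order all_algebra.
From mathcomp Require Import all_classical all_reals all_analysis.
From mathcomp Require Import measurable_realfun.
From mathcomp Require Import ring lra zify.
Import Order.TTheory GRing.Theory Num.Theory.
Import numFieldNormedType.Exports.

Local Open Scope classical_set_scope.
Local Open Scope ring_scope.

(** * Elementary inequalities *)

(** The obstacle: (b)(iii) is the only lower bound on ball masses that is uniform in [x], yet its
    [kappa] must not reach the limit. The moment estimate is therefore proved once with a free
    factor [eta] in that lower bound. It is used with [eta = 2^-1] at a fixed [x], on balls whose
    radius depends on [x], and with [eta = kappa] for the majorant. At fixed [x] the contribution of
    radii beyond those balls decays in [m / k], so doubling the constant absorbs it eventually. The
    pointwise bounds are inequalities and not limits, so dominated convergence is applied to the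
    maximum of the scaled moment and its asymptotic bound. Dyadic sums give no sharp constant and
    produce no Gamma function; it enters at the end through [c = 2 + C / Gamma (1 + q / d)], for
    which only its positivity matters. *)

Lemma powR_le_expR {R : realType} (a : R) : 0 <= a ->
  exists2 C : R, 0 < C & forall t, 0 <= t -> t `^ a <= C * expR t.
Proof.
move=> a0; pose n := (Num.truncn a).+1.
have an : a <= n%:R by apply/ltW/truncnS_gt.
exists (n`!%:R); first by rewrite ltr0n fact_gt0.
move=> t t0; have n1 : 1 <= n`!%:R :> R by rewrite ler1n fact_gt0.
have [t1|t1] := leP t 1.
  apply: (@le_trans _ _ 1).
    by have := ge0_ler_powR a0 t0 (ler01 : 0 <= 1 :> R) t1; rewrite powR1.
  by rewrite (le_trans n1)// ler_peMr// -expR0 ler_expR.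
apply: (@le_trans _ _ (t ^+ n)).
  by rewrite -powR_mulrn// ler_powR// ltW.
have := expR_ge1Dxn n.-1 t0; rewrite prednK// => h.
rewrite mulrC -ler_pdivrMr ?ltr0n ?fact_gt0//.
by apply: le_trans h; rewrite lerDr.
Qed.

Lemma powR_le_expR_scale {R : realType} (a : R) : 0 <= a ->
  exists2 C : R, 0 < C &
    forall b t, 0 < b -> 0 <= t -> t `^ a * expR (- (b * t)) <= C / b `^ a.
Proof.
move=> a0; have [C C0 H] := powR_le_expR a a0; exists C => // b t b0 t0.
rewrite ler_pdivlMr ?powR_gt0// mulrAC -powRM//; last exact: ltW.
rewrite expRN ler_pdivrMr ?expR_gt0// mulrC; apply: H.
by rewrite mulr_ge0// ltW.
Qed.

Lemma nneseries_le_geometric {R : realType} (u : nat -> R) (C : R) :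
  (forall i, 0 <= u i <= C / 2 ^+ i) ->
  (\sum_(0 <= i <oo) (u i)%:E <= (2 * C)%:E)%E.
Proof.
move=> uC; apply: lime_le.
  by apply: is_cvg_nneseries => i _ _; rewrite lee_fin; case/andP: (uC i).
apply: nearW => n; rewrite sumEFin lee_fin.
have C0 : 0 <= C.
  by have /andP[u0 uC0] := uC 0%N; rewrite expr0 divr1 in uC0; exact: le_trans uC0.
(* The subtracted term makes the bound on partial sums stable under induction. *)
apply: (@le_trans _ _ (2 * C - 2 * C / 2 ^+ n)); last first.
  by rewrite gerBl// divr_ge0 ?mulr_ge0 ?exprn_ge0.
elim: n => [|n IH]; first by rewrite big_geq// expr0 divr1 subrr.
rewrite big_nat_recr//=; have /andP[_ un] := uC n.
apply: (le_trans (lerD IH un)).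
rewrite exprS le_eqVlt; apply/orP; left; apply/eqP.
by field; rewrite expf_neq0.
Qed.

Lemma nneseries_dyadic_expR {R : realType} (q b : R) : 0 <= q -> 0 < b ->
  exists2 C : R, 0 <= C &
    (\sum_(0 <= i <oo) ((2 ^+ i) `^ q * expR (- (b * 2 ^+ i)))%:E <= C%:E)%E.
Proof.
move=> q0 b0; have [C C0 H] := powR_le_expR_scale (q + 1) (addr_ge0 q0 ler01).
exists (2 * (C / b `^ (q + 1))).
  by rewrite mulr_ge0// divr_ge0 ?powR_ge0// ltW.
apply: nneseries_le_geometric => i.
rewrite mulr_ge0 ?powR_ge0 ?expR_ge0//=.
have p0 : 0 < 2 ^+ i :> R by rewrite exprn_gt0.
rewrite ler_pdivlMr// mulrAC -[X in _ * X * _]powRr1; last exact: ltW.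
rewrite -powRD; last by rewrite (gt_eqF p0) implybT.
by apply: H => //; exact: ltW.
Qed.

Lemma dyadic_scale {R : realType} (s D : R) : 0 < s -> s < D ->
  exists i : nat, 2 ^+ i * s < D <= 2 ^+ i.+1 * s.
Proof.
move=> s0 sD.
have ex : exists i : nat, D <= 2 ^+ i * s.
  exists (Num.truncn (D / s)).+1; rewrite -ler_pdivrMr//.
  apply: (le_trans (ltW (truncnS_gt _))).
  by rewrite -natrX ler_nat ltnW// ltn_expl.
case: (ex_minnP ex) => -[|i] Di mi.
  by rewrite expr0 mul1r leNgt sD in Di.
exists i; rewrite Di andbT ltNge; apply/negP => h.
by have := mi _ h; rewrite ltnn.
Qed.

(** * Moments from tail bounds over dyadic radii *)

Section layer_cake.
Context {R : realType}.
Local Open Scope ereal_scope.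

(** Exactly one of four cases supplies a term that already dominates: [D > rR], [rho < D <= rR],
    [s < D <= rho], or [D] below all thresholds. No order among [s], [rho] and [rR] is assumed,
    since [s] will vary with [m] while the other two are fixed by the point. *)
Lemma dyadic_layer_cake (D s rho rR q : R) :
  (0 <= q)%R -> (0 <= D)%R -> (0 < s)%R -> (0 < rR)%R ->
  (D `^ q)%:E <= (s `^ q)%:E
    + \sum_(0 <= i <oo) (((2 ^+ i.+1 * s) `^ q) * (2 ^+ i * s <= rho)%R%:R *
                         (2 ^+ i * s < D)%R%:R)%:E
    + ((rR `^ q) * (rho < D)%R%:R)%:E
    + \sum_(0 <= i <oo) (((2 ^+ i.+1 * rR) `^ q) * (2 ^+ i * rR < D)%R%:R)%:E.
Proof.
move=> q0 D0 s0 rR0.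
pose u i := (((2 ^+ i.+1 * s) `^ q) * (2 ^+ i * s <= rho)%R%:R *
             (2 ^+ i * s < D)%R%:R)%:E.
pose v i := (((2 ^+ i.+1 * rR) `^ q) * (2 ^+ i * rR < D)%R%:R)%:E.
pose w := ((rR `^ q) * (rho < D)%R%:R)%:E.
change ((D `^ q)%:E <= (s `^ q)%:E + \sum_(0 <= i <oo) u i + w
                       + \sum_(0 <= i <oo) v i).
have u0 i : 0 <= u i by rewrite lee_fin !mulr_ge0// powR_ge0.
have v0 i : 0 <= v i by rewrite lee_fin mulr_ge0// powR_ge0.
have su0 : 0 <= \sum_(0 <= i <oo) u i by apply: nneseries_ge0 => i _ _; exact: u0.
have sv0 : 0 <= \sum_(0 <= i <oo) v i by apply: nneseries_ge0 => i _ _; exact: v0.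
have w0 : 0 <= w by rewrite lee_fin mulr_ge0// powR_ge0.
have sq0 : 0 <= (s `^ q)%:E by rewrite lee_fin powR_ge0.
have lu i : u i <= \sum_(0 <= i <oo) u i.
  apply: le_trans (nneseries_lim_ge i.+1 _); last by move=> n _ _; exact: u0.
  by rewrite big_mkord (bigD1 (Ordinal (ltnSn i)))//= leeDl// sume_ge0.
have lv i : v i <= \sum_(0 <= i <oo) v i.
  apply: le_trans (nneseries_lim_ge i.+1 _); last by move=> n _ _; exact: v0.
  by rewrite big_mkord (bigD1 (Ordinal (ltnSn i)))//= leeDl// sume_ge0.
have mono t : (D <= t)%R -> (D `^ q <= t `^ q)%R.
  by move=> Dt; rewrite ge0_ler_powR// nnegrE// (le_trans D0).
have [DR|RD] := leP D rR; last first.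
  have [i /andP[iD Di]] := dyadic_scale rR D rR0 RD.
  apply: (@le_trans _ _ (v i)).
    by rewrite lee_fin iD mulr1; exact: mono.
  by apply: (le_trans (lv i)); rewrite leeDr// !adde_ge0.
have [Drho|rhoD] := leP D rho; last first.
  apply: (@le_trans _ _ w); first by rewrite lee_fin rhoD mulr1; exact: mono.
  by rewrite -addeA addeCA leeDl// !adde_ge0.
have [Ds|sD] := leP D s.
  apply: (@le_trans _ _ (s `^ q)%:E); first by rewrite lee_fin; exact: mono.
  by rewrite -2!addeA leeDl// !adde_ge0.
have [i /andP[iD Di]] := dyadic_scale s D s0 sD.
apply: (@le_trans _ _ (u i)).
  by rewrite lee_fin iD (le_trans (ltW iD) Drho) !mulr1; exact: mono.
by apply: (le_trans (lu i)); rewrite -addeA addeAC leeDr// !adde_ge0.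
Qed.

Lemma integral_dyadic_layer_cake {disp} {T : measurableType disp}
    (P : probability T R) (D : T -> R) (s rho rR q : R) :
  measurable_fun setT D -> (forall w, 0 <= D w)%R ->
  (0 <= q)%R -> (0 < s)%R -> (0 < rR)%R ->
  \int[P]_w (D w `^ q)%:E <= (s `^ q)%:E
    + \sum_(0 <= i <oo) (((2 ^+ i.+1 * s) `^ q) * (2 ^+ i * s <= rho)%R%:R)%:E *
                         P [set w | (2 ^+ i * s < D w)%R]
    + (rR `^ q)%:E * P [set w | (rho < D w)%R]
    + \sum_(0 <= i <oo) ((2 ^+ i.+1 * rR) `^ q)%:E *
                         P [set w | (2 ^+ i * rR < D w)%R].
Proof.
move=> mD D0 q0 s0 rR0.
have mset t : measurable [set w | (t < D w)%R].
  rewrite (_ : mkset _ = D @^-1` `]t, +oo[%classic); last first.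
    by apply/seteqP; split => w /=; rewrite in_itv/= andbT.
  by rewrite -[X in measurable X]setTI; exact: mD.
have indE t : (fun w => (t < D w)%R%:R : R) = \1_([set w | (t < D w)%R]).
  apply/funext => w; rewrite indicE; congr ((nat_of_bool _)%:R).
  by apply/idP/idP; rewrite inE.
have mind t : measurable_fun setT (fun w => (t < D w)%R%:R : R).
  by rewrite indE; exact: measurable_indic.
have intind t : \int[P]_w ((t < D w)%R%:R : R)%:E = P [set w | (t < D w)%R].
  rewrite -(setIT [set w | (t < D w)%R]) -integral_indic//.
  by apply: eq_integral => w _; rewrite -indE.
have mt (c t : R) : measurable_fun setT (fun w => (c * (t < D w)%R%:R)%:E).
  by apply/measurable_EFinP; apply: measurable_funM.
have int_t (c t : R) : (0 <= c)%R ->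
    \int[P]_w (c * (t < D w)%R%:R)%:E = c%:E * P [set w | (t < D w)%R].
  move=> c0; rewrite -intind -ge0_integralZl//=.
    by apply/measurable_EFinP.
have ser (c t : nat -> R) : (forall i, 0 <= c i)%R ->
    measurable_fun setT (fun w => \sum_(0 <= i <oo) (c i * (t i < D w)%R%:R)%:E) /\
    \int[P]_w (\sum_(0 <= i <oo) (c i * (t i < D w)%R%:R)%:E) =
    \sum_(0 <= i <oo) (c i)%:E * P [set w | (t i < D w)%R].
  move=> c0; split.
    apply: ge0_emeasurable_sum => // k x _ _.
    by rewrite lee_fin mulr_ge0.
  rewrite integral_nneseries//.
  - by apply: eq_eseriesr => i _; rewrite int_t.
  - by move=> i w _; rewrite lee_fin mulr_ge0.
pose c1 i := ((2 ^+ i.+1 * s) `^ q * (2 ^+ i * s <= rho)%R%:R)%R.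
pose c2 i := ((2 ^+ i.+1 * rR) `^ q)%R.
have c10 i : (0 <= c1 i)%R by rewrite mulr_ge0 ?powR_ge0.
have c20 i : (0 <= c2 i)%R by rewrite powR_ge0.
have [m1 I1] := ser c1 (fun i => 2 ^+ i * s)%R c10.
have [m2 I2] := ser c2 (fun i => 2 ^+ i * rR)%R c20.
have p1 w : 0 <= \sum_(0 <= i <oo) (c1 i * (2 ^+ i * s < D w)%R%:R)%:E.
  by apply: nneseries_ge0 => i _ _; rewrite lee_fin mulr_ge0.
have p2 w : 0 <= \sum_(0 <= i <oo) (c2 i * (2 ^+ i * rR < D w)%R%:R)%:E.
  by apply: nneseries_ge0 => i _ _; rewrite lee_fin mulr_ge0.
have p3 w : 0 <= ((rR `^ q) * (rho < D w)%R%:R)%:E.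
  by rewrite lee_fin mulr_ge0// powR_ge0.
have p4 : 0 <= (s `^ q)%:E by rewrite lee_fin powR_ge0.
apply: (@le_trans _ _ (\int[P]_w ((s `^ q)%:E
    + \sum_(0 <= i <oo) (c1 i * (2 ^+ i * s < D w)%R%:R)%:E
    + ((rR `^ q) * (rho < D w)%R%:R)%:E
    + \sum_(0 <= i <oo) (c2 i * (2 ^+ i * rR < D w)%R%:R)%:E))).
  apply: ge0_le_integral => //=.
  - by move=> w _; rewrite lee_fin powR_ge0.
  - apply/measurable_EFinP.
    by apply: (measurableT_comp (measurable_powR _)).
  - by repeat apply: emeasurable_funD => //.
  - by move=> w _; exact: dyadic_layer_cake.
rewrite ge0_integralD//=; last 2 first.
  - by move=> w _; rewrite !adde_ge0.
  - by repeat apply: emeasurable_funD => //.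
rewrite ge0_integralD//=; last 2 first.
  - by move=> w _; rewrite !adde_ge0.
  - by repeat apply: emeasurable_funD => //.
rewrite ge0_integralD//= I1 I2 int_t ?powR_ge0//.
rewrite integral_cst//= [in X in X <= _]probability_setT mule1.
exact: lexx.
Qed.

End layer_cake.

(** The constant is chosen before the probability space and all radii. This is possible because
    [y * lam * s ^ d = eta] turns the exponent at radius [2 ^ i * s] into [eta / 4 * (2 ^ i) ^ d],
    which is at least [eta / 4 * 2 ^ i] as [0 < d]: the near series then depends on [q] and [eta]
    alone, up to the factor [s ^ q]. *)
Lemma moment_bound {R : realType} (q eta : R) : 0 <= q -> 0 < eta ->
  exists2 C : R, 0 < C &
  forall (disp : measure_display) (T : measurableType disp)
    (P : probability T R) (D : T -> R) (d Q : nat) (y lam s rho rR K : R),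
  measurable_fun setT D -> (forall w, 0 <= D w) ->
  (0 < d)%N -> q + 1 <= Q%:R -> 0 < y -> 0 < lam -> 0 < s -> 0 < rho ->
  1 <= rR -> 0 <= K -> y * lam * s ^+ d = eta ->
  (forall r, 0 < r <= rho ->
     (P [set w | (r < D w)%R] <= (expR 1 * expR (- (y * lam * r ^+ d / 4)))%:E)%E) ->
  (forall r, rR <= r -> (P [set w | (r < D w)%R] <= (K / r ^+ Q)%:E)%E) ->
  (\int[P]_w (D w `^ q)%:E <=
   (C * s `^ q + rR `^ q * (expR 1 * expR (- (y * lam * rho ^+ d / 4)))
    + 2 * (2 `^ q * K))%:E)%E.
Proof.
move=> q0 eta0.
have eta40 : 0 < eta / 4 by rewrite divr_gt0.
have [C C0 HC] := nneseries_dyadic_expR q (eta / 4) q0 eta40.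
exists (1 + 2 `^ q * expR 1 * C).
  by rewrite ltr_wpDr// !mulr_ge0 ?powR_ge0 ?expR_ge0.
move=> disp T P D d Q y lam s rho rR K mD D0 d0 qQ y0 lam0 s0 rho0 rR1 K0 yls near far.
have rR0 : 0 < rR by exact: lt_le_trans rR1.
apply: (le_trans (integral_dyadic_layer_cake P D s rho rR q mD D0 q0 s0 rR0)).
rewrite !EFinD; apply: leeD; first apply: leeD.
- rewrite mulrDl mul1r EFinD leeD2l//.
  apply: (@le_trans _ _ (\sum_(0 <= i <oo) ((2 * s) `^ q * expR 1)%:E *
      ((2 ^+ i) `^ q * expR (- (eta / 4 * 2 ^+ i)))%:E)%E); last first.
    rewrite nneseriesZl/=; last first.
      by move=> i _; rewrite lee_fin mulr_ge0 ?powR_ge0 ?expR_ge0.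
    apply: (@le_trans _ _ (((2 * s) `^ q * expR 1)%:E * C%:E)%E).
      by apply: lee_wpmul2l => //; rewrite lee_fin mulr_ge0 ?powR_ge0 ?expR_ge0.
    rewrite -EFinM lee_fin powRM//; last exact: ltW.
    by rewrite le_eqVlt; apply/orP; left; apply/eqP; ring.
  apply: lee_nneseries => i _.
    by rewrite mule_ge0// lee_fin mulr_ge0// powR_ge0.
  have p0 : 0 < 2 ^+ i :> R by rewrite exprn_gt0.
  have [irho|_] := leP (2 ^+ i * s) rho; last first.
    by rewrite mulr0 mul0e -EFinM lee_fin !mulr_ge0 ?powR_ge0 ?expR_ge0.
  rewrite mulr1.
  have /near h : 0 < 2 ^+ i * s <= rho by rewrite mulr_gt0.
  apply: (@le_trans _ _ (((2 ^+ i.+1 * s) `^ q)%:E * _)%E).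
    by apply: lee_wpmul2l h; rewrite lee_fin powR_ge0.
  rewrite -!EFinM lee_fin.
  have -> : (2 ^+ i.+1 * s) `^ q = (2 * s) `^ q * (2 ^+ i) `^ q.
    rewrite -powRM ?mulr_ge0// ?ltW//; congr (_ `^ _).
    by rewrite exprS; ring.
  rewrite -!mulrA ler_wpM2l ?powR_ge0// mulrCA ler_wpM2l ?expR_ge0//.
  rewrite ler_wpM2l ?powR_ge0// ler_expR lerN2.
  rewrite exprMn.
  have -> : y * (lam * (2 ^+ i ^+ d * s ^+ d / 4)) = (eta / 4) * 2 ^+ i ^+ d.
    by rewrite -yls; field.
  rewrite mulrA ler_wpM2l//; first exact: ltW.
  by rewrite -[leLHS]expr1 ler_weXn2l// exprn_ege1// ler1n.
- rewrite EFinM; apply: lee_wpmul2l; first by rewrite lee_fin powR_ge0.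
  by apply: near; rewrite rho0/=.
- apply: (@le_trans _ _ (\sum_(0 <= i <oo)
      ((2 ^+ i.+1 * rR) `^ q * (K / (2 ^+ i * rR) ^+ Q))%:E)%E).
    apply: lee_nneseries => i _.
      by rewrite mule_ge0// lee_fin powR_ge0.
    rewrite EFinM; apply: lee_wpmul2l; first by rewrite lee_fin powR_ge0.
    by apply: far; rewrite ler_peMl ?exprn_ege1 ?ler1n// ltW.
  apply: nneseries_le_geometric => i.
  have p0 : 0 < 2 ^+ i :> R by rewrite exprn_gt0.
  set x := 2 ^+ i * rR.
  have x0 : 0 < x by rewrite mulr_gt0.
  have x1 : 1 <= x by rewrite mulr_ege1// exprn_ege1// ler1n.
  apply/andP; split.
    by rewrite mulr_ge0 ?powR_ge0// divr_ge0// exprn_ge0// ltW.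
  have -> : 2 ^+ i.+1 * rR = 2 * x by rewrite exprS mulrA.
  rewrite powRM//; last exact: ltW.
  rewrite -!mulrA ler_wpM2l ?powR_ge0// mulrCA ler_wpM2l//.
  rewrite ler_pdivrMr ?exprn_gt0//.
  (* From [q + 1 <= Q] follows [x ^ q / x ^ Q <= 1 / x], and [2 ^ i <= x] since [1 <= rR]: the far
     series is geometric. *)
  apply: (@le_trans _ _ (x `^ (Q%:R - 1))).
    by rewrite ler_powR// lerBrDr.
  rewrite powRB ?(gt_eqF x0) ?implybT// powR_mulrn ?(ltW x0)// powRr1 ?(ltW x0)//.
  rewrite mulrC ler_wpM2r ?exprn_ge0 ?(ltW x0)//.
  by rewrite lef_pV2 ?posrE// ler_peMr// ltW.
Qed.

(** * Binomial tails *)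

Lemma le_measure_bigsetU {R : realFieldType} {disp} {T : measurableType disp}
    (mu : {measure set T -> \bar R}) {I : Type} (s : seq I) (Q : pred I)
    (F : I -> set T) :
  (forall i, measurable (F i)) ->
  (mu (\big[setU/set0]_(i <- s | Q i) F i) <= \sum_(i <- s | Q i) mu (F i))%E.
Proof.
move=> mF; elim: s => [|i s IH]; first by rewrite !big_nil measure0.
rewrite !big_cons; case: ifPn => // _.
apply: le_trans (leeD2l _ IH).
by apply: measureU2 => //; exact: bigsetU_measurable.
Qed.

Section binomial_tail.
Context {R : realType} {disp disp' : measure_display}
  {Omega : measurableType disp} {T : measurableType disp'}
  {P : probability Omega R}.

(** This is Markov's inequality for [z ^ count], carried out on the finite partition by the set [S]
    of indices that hit [A]. When [#|S| < k] the weight [z ^ #|S|] is at least [z ^ k]; adding the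
    weighted probabilities of all [S] expands the [m]-th power of [1 - p + z * p]. *)
Lemma binomial_tail (X : nat -> {RV P >-> T}) (mu : probability T R)
    (A : set T) (z : R) (k m : nat) :
  iid X mu -> measurable A -> 0 < z <= 1 ->
  measurable [set w | (count (fun j => X j w \in A) (iota 0 m) < k)%N] /\
  (P [set w | (count (fun j => X j w \in A) (iota 0 m) < k)%N]
    <= (z ^- k * (1 - fine (mu A) + z * fine (mu A)) ^+ m)%:E)%E.
Proof.
move=> [indep law] mA /andP[z0 z1].
(* Independence is stated for families of sets indexed by [nat], so membership in [S] is extended to
   all naturals. [E S] is the event that the hitting indices below [m] are exactly those of [S]. *)
pose B (S : {set 'I_m}) (j : nat) : set T :=
  if [exists i in S, val i == j] then A else ~` A.
pose E (S : {set 'I_m}) := \big[setI/setT]_(j <- iota 0 m) (X j @^-1` B S j).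
have BE (S : {set 'I_m}) (i : 'I_m) : B S i = if i \in S then A else ~` A.
  rewrite /B; congr (if _ then _ else _); apply/existsP/idP => [[j /andP[jS]]|iS].
    by move=> /eqP/val_inj <-.
  by exists i; rewrite iS/=.
have mB S j : measurable (B S j) by rewrite /B; case: ifP => _ //; exact: measurableC.
have mE S : measurable (E S).
  apply: bigsetI_measurable => j _; rewrite -[X in measurable X]setTI.
  by apply: measurable_funP => //; exact: mB.
have EP S w : E S w <-> S = [set i : 'I_m | X i w \in A]%SET.
  rewrite /E -bigcap_seq; split=> [H|-> j /=].
    apply/setP => i; rewrite inE.
    have : B S i (X i w) by apply: H => /=; rewrite mem_iota/= add0n ltn_ord.
    rewrite BE; case: (i \in S) => h; first by rewrite mem_set.
    by rewrite memNset.
  rewrite mem_iota/= add0n => jm.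
  rewrite (_ : j = Ordinal jm)// BE inE/=.
  by case: ifPn => /= [|/negP h]; rewrite ?inE// => Aw; apply: h; rewrite inE.
have setE : [set w | (count (fun j => X j w \in A) (iota 0 m) < k)%N] =
    \big[setU/set0]_(S : {set 'I_m} | (#|S| < k)%N) E S.
  have cntE w : count (fun j => X j w \in A) (iota 0 m) =
      #|[set i : 'I_m | X i w \in A]%SET|.
    rewrite -sum1_count -[in LHS](subn0 m) -/(index_iota 0 m) big_mkord.
    by rewrite -sum1_card; apply: eq_bigl => i; rewrite inE.
  rewrite -bigcup_pred; apply/seteqP; split => w /=.
    by rewrite cntE => h; exists [set i : 'I_m | X i w \in A]%SET => //; exact/EP.
  by move=> [S /= Sk /EP SE]; rewrite cntE -SE.
split; first by rewrite setE; exact: bigsetU_measurable.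
rewrite setE; apply: (le_trans (le_measure_bigsetU _ _ _ _ mE)).
set p := fine (mu A).
have muA : mu A = p%:E by rewrite fineK// fin_num_measure.
have p0 : 0 <= p by rewrite fine_ge0.
have p1 : p <= 1 by rewrite -lee_fin -muA probability_le1.
have PB S (i : 'I_m) : P (X i @^-1` B S i) = (if i \in S then p else 1 - p)%:E.
  rewrite -[LHS]/(distribution P (X i) (B S i)) law; last exact: mB.
  rewrite BE; case: ifP => _; first by rewrite muA.
  by rewrite probability_setC// muA -EFinB.
have PE S : P (E S) = (\prod_(i < m) (if i \in S then p else 1 - p))%:E.
  rewrite /E indep ?iota_uniq//.
  rewrite -[in LHS](subn0 m) -/(index_iota 0 m) big_mkord -prodEFin.
  by apply: eq_bigr => i _; exact: PB.
rewrite (eq_bigr _ (fun S _ => PE S)) sumEFin lee_fin.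
rewrite mulrC ler_pdivlMr ?exprn_gt0//.
rewrite -[m in leRHS]card_ord -prodr_const.
rewrite [1 - p + _]addrC bigA_distr mulr_suml big_mkcond/=.
apply: ler_sum => S _.
have -> : \prod_(i < m) (if i \in S then z * p else 1 - p) =
    z ^+ #|S| * \prod_(i < m) (if i \in S then p else 1 - p).
  rewrite -prodr_const (big_mkcond (fun i => i \in S)) -big_split/=.
  by apply: eq_bigr => i _; case: ifP => _ //; rewrite mul1r.
have pr0 : 0 <= \prod_(i < m) (if i \in S then p else 1 - p).
  by apply: prodr_ge0 => i _; case: ifP => _//; rewrite subr_ge0.
case: ifPn => Sk; last by rewrite mulr_ge0// exprn_ge0// ltW.
by rewrite mulrC ler_wpM2r// ler_wiXn2l ?(ltW z0)// ltnW.
Qed.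

End binomial_tail.

(** * Nearest-neighbour distances *)

(** In a sorted list the elements satisfying a downward closed predicate form a prefix. *)
Lemma count_sorted_prefix {T : eqType} (e : rel T) (a : pred T) (s : seq T) (k : nat) :
  transitive e -> (forall x y, e x y -> a y -> a x) -> sorted e s ->
  (k <= size s)%N -> (k <= count a s)%N = all a (take k s).
Proof.
move=> etr ea; elim: s k => [|x s IH] [|k]//= /[dup] exs /path_sorted es ks.
have [ax|nax] := boolP (a x); first by rewrite ltnS IH.
rewrite add0n (_ : count a s = 0)//; apply/eqP; rewrite -leqn0 leqNgt -has_count.
apply/hasPn => y ys; apply: contra nax.
by apply: ea; have /allP := order_path_min etr exs; exact.
Qed.

Section nn_dist.
Context {R : realType} {d : nat} (N : 'rV[R]_d -> R).

(** Neighbours are sorted by distance, so for [0 < k <= m] and a norm [N] this maximum is the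
    distance to the [k]-th one. As a maximum it bounds the distance to each of the [k] neighbours at
    once, which is how the coupling cost uses it. *)
Definition nn_dist (k m : nat) (x' : nat -> 'rV[R]_d) (x : 'rV[R]_d) : R :=
  \big[Num.max/0]_(l < k) N (x - x' (nn_index N m x' x l)).

Let nn_rel (x' : nat -> 'rV[R]_d) (x : 'rV[R]_d) : rel nat := fun i j =>
  (N (x - x' i) < N (x - x' j)) || ((N (x - x' i) == N (x - x' j)) && (i <= j)%N).

Let nn_rel_trans x' x : transitive (nn_rel x' x).
Proof.
move=> j i l /orP[ij|/andP[/eqP ij ilj]] /orP[jl|/andP[/eqP jl jll]]; apply/orP.
- by left; exact: lt_trans jl.
- by left; rewrite -jl.
- by left; rewrite ij.
- by right; rewrite ij jl eqxx (leq_trans ilj).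
Qed.

Let nn_rel_total x' x : total (nn_rel x' x).
Proof.
move=> i j; rewrite /nn_rel; case: ltgtP => //= _; exact: leq_total.
Qed.

Lemma nn_index_lt m x' x l : (l < m)%N -> (nn_index N m x' x l < m)%N.
Proof.
move=> lm; suff : nn_index N m x' x l \in iota 0 m by rewrite mem_iota add0n.
by rewrite /nn_index -(mem_sort (nn_rel x' x)) mem_nth// size_sort size_iota.
Qed.

Lemma nn_dist_ge0 k m x' x : 0 <= nn_dist k m x' x.
Proof. exact: bigmax_ge_id. Qed.

Lemma nn_dist_ge k m x' x l : (l < k)%N ->
  N (x - x' (nn_index N m x' x l)) <= nn_dist k m x' x.
Proof.
by move=> lk; apply: (le_bigmax _ (fun l : 'I_k => N (x - x' (nn_index N m x' x l))) (Ordinal lk)).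
Qed.

(** Replaces sorting by counting: probability and measurability arguments from here on only see how
    many sample points lie in a ball. *)
Lemma nn_dist_le k m x' x r : (k <= m)%N -> 0 <= r ->
  (nn_dist k m x' x <= r) =
  (k <= count (fun j => x' j \in norm_ball N x r) (iota 0 m))%N.
Proof.
move=> km r0; set a := fun j => _.
have aE j : a j = (N (x - x' j) <= r) by apply/idP/idP; rewrite inE.
set s := sort (nn_rel x' x) (iota 0 m).
have ss : size s = m by rewrite size_sort size_iota.
have -> : count a (iota 0 m) = count a s.
  by apply/permP; rewrite perm_sym; apply/permPl; exact: perm_sort.
rewrite (@count_sorted_prefix _ (nn_rel x' x))//; last 3 first.
- move=> i j /orP[ij|/andP[/eqP ij _]]; rewrite !aE; last by rewrite ij.
  by move=> h; exact: (le_trans (ltW ij)).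
- exact: sort_sorted.
- by rewrite ss.
apply/idP/idP => [/bigmax_leP[_ h]|h].
  apply/(all_nthP 0%N) => l; rewrite size_takel ?ss// => lk.
  by rewrite nth_take// aE; exact: (h (Ordinal lk)).
apply/bigmax_leP; split=> // -[l lk] _ /=.
have /(all_nthP 0%N) /(_ l) := h; rewrite size_takel ?ss// => /(_ lk).
by rewrite nth_take// aE.
Qed.

End nn_dist.

(** * Tail bounds for the distance to the k-th neighbour *)

Section nn_dist_tail.
Context {R : realType} {d : nat} (N : 'rV[R]_d -> R).
Context {disp : measure_display} {Omega : measurableType disp}
  {P : probability Omega R}.
Variables (X' : nat -> {RV P >-> 'rV[R]_d}) (muX' : probability 'rV[R]_d R).
Hypothesis X'iid : iid X' muX'.
Hypothesis mball : forall x r, measurable (norm_ball N x r).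
Local Notation dist k m x := (fun w => nn_dist N k m (fun j => X' j w) x).
Local Notation F x r := (fine (muX' (norm_ball N x r))).

Lemma nn_dist_gt_setE k m x r : (k <= m)%N -> 0 <= r ->
  [set w | r < dist k m x w] =
  [set w | (count (fun j => X' j w \in norm_ball N x r) (iota 0 m) < k)%N].
Proof.
move=> km r0; apply/seteqP; split=> w /=.
  by rewrite ltNge nn_dist_le// -ltnNge.
by move=> h; rewrite ltNge nn_dist_le// -ltnNge.
Qed.

Let F01 x r : 0 <= F x r <= 1.
Proof.
rewrite fine_ge0//= -lee_fin fineK ?fin_num_measure//; exact: probability_le1.
Qed.

(** The binomial bound with [z = 2^-1] is at most [e ^ (k * (1 - u))] for [u = m * F / (2 * k)]. For
    [u >= 2] this is at most [e ^ (1 - u / 2)], since [k >= 1]; for [u < 2] the latter exceeds 1 and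
    there is nothing to prove. Hence a bound that depends on [k] only through [m / k]. *)
Lemma nn_dist_tail_exp k m x r : (0 < k <= m)%N -> 0 <= r ->
  (P [set w | (r < dist k m x w)%R] <=
    (expR 1 * expR (- (m%:R / k%:R * F x r / 4)))%:E)%E.
Proof.
move=> /andP[k0 km] r0; rewrite nn_dist_gt_setE//.
have /andP[f0 f1] := F01 x r; set f := F x r in f0 f1 *.
have h2 : 0 < (2^-1 : R) <= 1 by rewrite invr_gt0 ltr0n/= invf_le1// ler1n.
have [mcnt tail] := binomial_tail X' muX' _ 2^-1 k m X'iid (mball x r) h2.
rewrite -/f in tail.
set u := m%:R / k%:R * f / 2.
have kR0 : 0 < k%:R :> R by rewrite ltr0n.
have k1 : 1 <= k%:R :> R by rewrite ler1n.
have -> : m%:R / k%:R * f / 4 = u / 2 by rewrite /u; field; rewrite (gt_eqF kR0).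
rewrite -expRD.
have [u2|u2] := ltP u 2.
  apply: (@le_trans _ _ 1%E); first exact: probability_le1.
  by rewrite lee_fin -[leLHS]expR0 ler_expR; lra.
apply: (le_trans tail); rewrite lee_fin.
apply: (@le_trans _ _ (expR (k%:R * (1 - u)))); last first.
  rewrite ler_expR.
  have : 0 <= (k%:R - 1) * (u - 1) by rewrite mulr_ge0//; lra.
  lra.
have -> : k%:R * (1 - u) = k%:R * 1 + m%:R * - (f / 2).
  by rewrite /u; field; rewrite (gt_eqF kR0).
rewrite expRD !expRM_natl.
apply: ler_pM.
- by rewrite invr_ge0 exprn_ge0// invr_ge0.
- by rewrite exprn_ge0//; lra.
- by rewrite exprVn invrK lerXn2r ?nnegrE ?expR_ge0// (le_trans _ (expR_ge1Dx 1))//; lra.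
- rewrite lerXn2r ?nnegrE ?expR_ge0//; first lra.
  by apply: le_trans (expR_ge1Dx _); lra.
Qed.

(** With weight [g] and [1 - F <= g], the binomial bound is at most [2 ^ m * g ^ (m - k)]. Of the
    factors [g], [m0 * Q] are spent on the polynomial decay [(M / r) ^ Q]; each of the others is at
    most [e ^ - 3]. Against [2 ^ m <= e ^ m] they leave [e ^ - m], because [3 * k <= m], at the
    price of [e ^ (3 * m0 * Q)]. *)
Lemma nn_dist_tail_far k m m0 Q x r M : (3 * k <= m)%N -> (0 < m0)%N ->
  (m0 * Q + k <= m)%N -> 0 < r -> 0 < M -> M / r <= expR (- 3) ^+ m0 ->
  (1 - F x r) ^+ m0 <= M / r ->
  (P [set w | (r < dist k m x w)%R] <=
    (M ^+ Q * expR 3 ^+ (m0 * Q) * expR (- m%:R) / r ^+ Q)%:E)%E.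
Proof.
move=> km m00 mQ r0 M0 Mr GM.
have km' : (k <= m)%N by exact: leq_trans (leq_pmull k (isT : 0 < 3)%N) km.
rewrite nn_dist_gt_setE ?(ltW r0)//.
have /andP[f0 f1] := F01 x r; set f := F x r in f0 f1 GM *.
set t := M / r in Mr GM.
have t0 : 0 < t by rewrite divr_gt0.
(* The weight [z] of [binomial_tail] is chosen with [z ^ m0 = M / r]. *)
pose g := t `^ (m0%:R^-1).
have g0 : 0 < g by rewrite powR_gt0.
have gE : g ^+ m0 = t.
  rewrite -powR_mulrn ?(ltW g0)// /g -powRrM mulVf ?pnatr_eq0 -?lt0n//.
  by rewrite powRr1// ltW.
have ge3 : g <= expR (- 3).
  by rewrite -(@ler_pXn2r _ m0)// ?nnegrE ?expR_ge0 ?(ltW g0)// gE.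
have Gg : 1 - f <= g.
  by rewrite -(@ler_pXn2r _ m0)// ?nnegrE ?(ltW g0) ?subr_ge0// gE.
have e3 : expR (- 3) <= 1 :> R by rewrite -[leRHS]expR0 ler_expR; lra.
have g1 : 0 < g <= 1 by rewrite g0 (le_trans ge3).
have [mcnt tail] := binomial_tail X' muX' _ g k m X'iid (mball x r) g1.
apply: (le_trans tail); rewrite lee_fin -/f.
apply: (@le_trans _ _ (g ^- k * (2 * g) ^+ m)).
  rewrite ler_wpM2l ?invr_ge0 ?exprn_ge0 ?(ltW g0)//.
  rewrite lerXn2r ?nnegrE ?mulr_ge0 ?(ltW g0)//.
    by rewrite addr_ge0 ?subr_ge0// mulr_ge0// ltW.
  have : g * f <= g by rewrite ler_piMr// ltW.
  lra.
have mE : m = (k + (m0 * Q + (m - k - m0 * Q)))%N.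
  by rewrite addnA -subnDA subnKC// addnC.
have -> : g ^- k * (2 * g) ^+ m = 2 ^+ m * (t ^+ Q * g ^+ (m - k - m0 * Q)).
  have -> : (2 * g) ^+ m = 2 ^+ m * (g ^+ k * (t ^+ Q * g ^+ (m - k - m0 * Q))).
    by rewrite exprMn -gE -exprM -!exprD -mE.
  by field; rewrite expf_neq0// gt_eqF.
have -> : M ^+ Q * expR 3 ^+ (m0 * Q) * expR (- m%:R) / r ^+ Q =
    expR (- m%:R) * (t ^+ Q * expR 3 ^+ (m0 * Q)).
  by rewrite /t expr_div_n; ring.
rewrite mulrCA [leRHS]mulrCA ler_wpM2l ?exprn_ge0 ?(ltW t0)//.
apply: (@le_trans _ _ (expR 1 ^+ m * expR (- 3) ^+ (m - k - m0 * Q))).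
  apply: ler_pM; rewrite ?exprn_ge0 ?(ltW g0)//.
    by rewrite lerXn2r ?nnegrE ?expR_ge0// (le_trans _ (expR_ge1Dx 1))//; lra.
  by rewrite lerXn2r ?nnegrE ?expR_ge0// ltW.
rewrite -!expRM_natr -!expRD ler_expR.
have : (m - k - m0 * Q)%:R = m%:R - k%:R - (m0 * Q)%:R :> R.
  by rewrite !natrB// leq_subRL// addnC.
move=> ->; have : 3 * k%:R <= m%:R :> R by rewrite -natrM ler_nat.
lra.
Qed.

End nn_dist_tail.

(** * Lebesgue measure of norm balls *)

Lemma pushforward_measureP {R : realFieldType} {disp disp'}
    {T : measurableType disp} {U : measurableType disp'}
    (mu : {measure set T -> \bar R}) (f : T -> U) : measurable_fun setT f ->
  exists nu : {measure set U -> \bar R}, forall A, nu A = mu (f @^-1` A).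
Proof.
move=> mf.
by exists (measure_function_pushforward__canonical__measure_function_Measure mu mf).
Qed.

Section lebesgue_affine.
Context {R : realType}.

(** The rescaled image of Lebesgue measure under the affine map has the right values on half-open
    intervals, and these determine it. *)
Lemma lebesgue_measure_affine (a r : R) (A : set R) : 0 < r -> measurable A ->
  lebesgue_measure A =
  (r%:E * lebesgue_measure ((fun t => (a + r * t)%R) @^-1` A))%E.
Proof.
move=> r0 mA; pose f := fun t : measurableTypeR R => (a + r * t)%R : measurableTypeR R.
have mf : measurable_fun setT f.
  by apply: measurable_funD => //; exact: measurable_funM.
have [nu nuE] := pushforward_measureP (@lebesgue_measure R) f mf.
pose nu' : {measure set (measurableTypeR R) -> \bar R} := mscale (NngNum (ltW r0)) nu.
have -> : (r%:E * lebesgue_measure (f @^-1` A))%E = nu' A by rewrite -nuE.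
apply: lebesgue_measure_unique => // _ [[x y] _ <-]/=.
rewrite /nu' /= /mscale/= nuE.
have -> : f @^-1` `]x, y]%classic = `](x - a) / r, (y - a) / r]%classic.
  apply/seteqP; split => t /=; rewrite !in_itv/= /f => /andP[h1 h2]; apply/andP; split.
  - by rewrite ltr_pdivrMr// ltrBlDl mulrC.
  - by rewrite ler_pdivlMr// lerBrDl mulrC.
  - by rewrite ltr_pdivrMr// ltrBlDl mulrC in h1.
  - by rewrite ler_pdivlMr// lerBrDl mulrC in h2.
rewrite lebesgue_measure_itv [X in (_ * X)%E](lebesgue_measure_itv `](x - a) / r, (y - a) / r]).
rewrite /= !lte_fin ltr_pM2r ?invr_gt0// ltrD2r.
case: ifPn => _; last by rewrite mule0.
rewrite -!EFinB -EFinM; congr EFin.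
by field; rewrite gt_eqF.
Qed.

(** Induction on the dimension: through [cons_rV] the map acts separately on the first coordinate
    and on the rest, and a product measure is determined by its values on rectangles. *)
Lemma lebesgue_rV_affine d (a : 'rV[R]_d) (r : R) (A : set 'rV[R]_d) :
  0 < r -> measurable A ->
  lebesgue_rV A =
  ((r ^+ d)%:E * lebesgue_rV ((fun t => (a + r *: t)%R) @^-1` A))%E.
Proof.
move=> r0; elim: d a A => [|d IH] a A mA.
  have -> : (fun t => a + r *: t) @^-1` A = A.
    by apply/seteqP; split=> t; rewrite /preimage/= (thinmx0 (a + _)) (thinmx0 t).
  by rewrite expr0 mul1e.
pose f (t : measurableTypeR R) : measurableTypeR R := a ord0 ord0 + r * t.
pose g (t : 'rV[R]_d) := (uncons_rV a).2 + r *: t.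
pose fg (z : measurableTypeR R * 'rV[R]_d) := (f z.1, g z.2).
have mf : measurable_fun setT f.
  by apply: measurable_funD => //; exact: measurable_funM.
have mg : measurable_fun setT g.
  apply: measurable_fun_rV => i.
  apply: (eq_measurable_fun (fun t : 'rV[R]_d => (uncons_rV a).2 ord0 i + r * t ord0 i)).
    by move=> t _; rewrite !mxE.
  by apply: measurable_funD => //; apply: measurable_funM => //; exact: measurable_coord.
have mfg : measurable_fun setT fg.
  by apply: measurable_fun_pair; apply: measurableT_comp.
pose pr : {measure set (measurableTypeR R * 'rV[R]_d) -> \bar R} :=
  (@lebesgue_measure R \x @lebesgue_rV R d)%E.
have [nu nuE] := pushforward_measureP pr fg mfg.
have r0d : 0 <= r ^+ d.+1 by rewrite exprn_ge0// ltW.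
pose nu' : {measure set (measurableTypeR R * 'rV[R]_d) -> \bar R} := mscale (NngNum r0d) nu.
have fgE z : a + r *: cons_rV z = cons_rV (fg z).
  case: z => t v; apply/rowP => i /=; rewrite !mxE.
  by case: unliftP => [j ->|->]//=; rewrite !mxE.
rewrite /= /pushforward.
have -> : cons_rV (d := d) @^-1` ((fun t => a + r *: t) @^-1` A) =
    fg @^-1` (cons_rV (d := d) @^-1` A).
  by apply/seteqP; split=> z /=; rewrite fgE.
set B := cons_rV (d := d) @^-1` A.
have mB : measurable B.
  by rewrite -[X in measurable X]setTI; exact: measurable_cons_rV.
transitivity (nu' B); last by rewrite /nu' /= /mscale/= nuE.
apply: product_measure_unique => // C D mC mD.
rewrite /nu' /= /mscale/= nuE.
have -> : fg @^-1` (C `*` D) = (f @^-1` C) `*` (g @^-1` D) by [].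
have -> : pr (f @^-1` C `*` g @^-1` D) =
    (lebesgue_measure (f @^-1` C) * lebesgue_rV (g @^-1` D))%E.
  by apply: product_measure1E; rewrite -[X in measurable X]setTI;
    [exact: mf|exact: mg].
rewrite (IH (uncons_rV a).2 D mD) (lebesgue_measure_affine (a ord0 ord0) r C r0 mC).
by rewrite exprS EFinM muleACA.
Qed.

End lebesgue_affine.

(** * Equivalence of norms and volumes of norm balls *)

Section norm_facts.
Context {R : realType} {d : nat} {N : 'rV[R]_d -> R}.
Hypothesis Nnorm : is_norm N.

Lemma is_norm0 : N 0 = 0.
Proof. by rewrite -(scale0r 0) (is_norm_scale Nnorm) normr0 mul0r. Qed.

Lemma is_normN x : N (- x) = N x.
Proof. by rewrite -scaleN1r (is_norm_scale Nnorm) normrN normr1 mul1r. Qed.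

Lemma is_norm_ge0 x : 0 <= N x.
Proof.
have := is_norm_triangle Nnorm x (- x).
by rewrite subrr is_norm0 is_normN -mulr2n pmulrn_lge0.
Qed.

Lemma is_norm_distC x y : N (x - y) = N (y - x).
Proof. by rewrite -opprB is_normN. Qed.

Lemma is_norm_le_normr : exists2 C : R, 0 < C & forall x, N x <= C * `|x|.
Proof.
have xi (x : 'rV[R]_d) i : `|x ord0 i| <= `|x|.
  rewrite [leRHS]/Num.norm/= mx_normrE.
  by apply: (le_bigmax _ (fun ij : 'I_1 * 'I_d => `|x ij.1 ij.2|) (ord0, i)).
exists (1 + \sum_i N (delta_mx ord0 i)).
  by rewrite ltr_wpDr// sumr_ge0// => i _; exact: is_norm_ge0.
move=> x; rewrite mulrDl mul1r ler_wpDl// mulr_suml {1}(row_sum_delta x).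
elim/big_ind2 : _ => [|a b u v ab uv|i _]; first by rewrite is_norm0.
  by rewrite (le_trans (is_norm_triangle Nnorm _ _))// lerD.
by rewrite (is_norm_scale Nnorm) mulrC ler_wpM2l// is_norm_ge0.
Qed.

Lemma is_norm_continuous : continuous N.
Proof.
have [C C0 NC] := is_norm_le_normr.
move=> x; apply/(@cvgrPdist_le _ _ _ (nbhs x) (nbhs_filter x) N (N x)) => e e0; apply/nbhs_ballP.
exists (e / C) => /=; first by rewrite divr_gt0.
move=> y; rewrite -ball_normE /ball_/= => /ltW; rewrite ler_pdivlMr// mulrC => xy.
rewrite (le_trans _ xy)//; apply: le_trans (NC _).
rewrite ler_norml; apply/andP; split.
  rewrite lerNl opprB lerBlDr is_norm_distC.
  by apply: le_trans (is_norm_triangle Nnorm _ _); rewrite subrK.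
rewrite lerBlDr.
by apply: le_trans (is_norm_triangle Nnorm _ _); rewrite subrK.
Qed.

Lemma normr_le_is_norm : exists2 C : R, 0 < C & forall x, `|x| <= C * N x.
Proof.
pose S := [set x : 'rV[R]_d | `|x| = 1].
have cS : compact S.
  apply: bounded_closed_compact.
    by exists 1; split=> // M M1 x /= ->; exact: ltW.
  have -> : S = (fun x : 'rV[R]_d => `|x|) @^-1` [set 1] by [].
  by apply: closed_comp => [x _|]; [exact: norm_continuous|exact: closed_eq].
have cNS : closed (N @` S).
  apply: compact_closed; first exact: Rhausdorff.
  by apply: continuous_compact => //; apply: continuous_subspaceT; exact: is_norm_continuous.
(* The image of the sphere is closed and misses 0, so [N] is bounded away from 0 on it. Arguing with
   the image and not with a minimiser covers dimension 0, where the sphere is empty. *)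
have : nbhs (0 : R) (~` (N @` S)).
  apply: open_nbhs_nbhs; split; first exact: closed_openC.
  by move=> [x xS /(is_norm_eq0 Nnorm) x0]; move: xS; rewrite /S/= x0 normr0 => /esym/eqP; rewrite oner_eq0.
move=> /nbhs_ballP[e /= e0 He].
exists e^-1; first by rewrite invr_gt0.
move=> x; have [->|x0] := eqVneq x 0.
  by rewrite normr0 mulr_ge0 ?is_norm_ge0// invr_ge0 ltW.
have nx0 : 0 < `|x| by rewrite normr_gt0.
rewrite mulrC ler_pdivlMr// mulrC -ler_pdivlMr// mulrC.
rewrite leNgt; apply/negP => Ne.
apply: (He (N (`|x|^-1 *: x))).
  rewrite /ball/= sub0r normrN (is_norm_scale Nnorm) ger0_norm ?mulr_ge0 ?is_norm_ge0//.
  by rewrite normfV normr_id.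
exists (`|x|^-1 *: x) => //.
by rewrite /S/= normrZ normfV normr_id mulVf// gt_eqF.
Qed.

Lemma closed_norm_ball x r : closed (norm_ball N x r).
Proof.
have -> : norm_ball N x r = (fun y => N (x - y)) @^-1` [set t | t <= r] by [].
have cN : continuous (fun y : 'rV[R]_d => N (x - y)).
  move=> y; apply: (@continuous_comp _ _ _ (fun y : 'rV[R]_d => x - y) N).
    by apply: (@continuousB _ _ _ (fun=> x) id); [exact: cst_continuous|move=> ?].
  exact: is_norm_continuous.
by apply: closed_comp => [y _|]; [exact: cN|exact: closed_le].
Qed.

Lemma measurable_norm_ball x r : measurable (norm_ball N x r).
Proof.
rewrite -(setCK (norm_ball N x r)); apply: measurableC.
by apply: open_measurable_rV; exact/closed_openC/closed_norm_ball.
Qed.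

Lemma measurable_norm : measurable_fun setT N.
Proof.
apply: (measurability _ (@RGenOpens.measurableE R)) => // _ [_ [a [b ->]] <-].
rewrite setTI; apply: open_measurable_rV; apply: open_comp; last exact: interval_open.
by move=> v _; exact: is_norm_continuous.
Qed.

Lemma norm_ball_sub_normr_ball x (e : R) : 0 < e ->
  exists2 r : R, 0 < r & norm_ball N x r `<=` ball x e.
Proof.
move=> e0; have [C C0 H] := normr_le_is_norm.
exists (e / (2 * C)); first by rewrite divr_gt0// mulr_gt0.
move=> y /= xy; rewrite -ball_normE /ball_/=.
apply: (le_lt_trans (H _)); apply: (@le_lt_trans _ _ (C * (e / (2 * C)))).
  by rewrite ler_pM2l.
have -> : C * (e / (2 * C)) = e / 2 by field; rewrite gt_eqF.
by rewrite ltr_pdivrMr// ltr_pMr// ltr1n.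
Qed.

Lemma normr_ball_sub_norm_ball x (r : R) : 0 < r ->
  exists2 e : R, 0 < e & ball x e `<=` norm_ball N x r.
Proof.
move=> r0; have [C C0 H] := is_norm_le_normr.
exists (r / C); first by rewrite divr_gt0.
move=> y; rewrite -ball_normE /ball_/= => xy.
apply: (le_trans (H _)); rewrite mulrC -ler_pdivlMr//; exact: ltW.
Qed.

Lemma lebesgue_norm_ball_scale x r : 0 < r ->
  lebesgue_rV (norm_ball N x r) = ((r ^+ d)%:E * lebesgue_rV (norm_ball N 0 1))%E.
Proof.
move=> r0; rewrite (lebesgue_rV_affine _ x r)//; last exact: measurable_norm_ball.
congr (_ * lebesgue_rV _)%E; apply/seteqP; split=> t; rewrite /norm_ball/=;
  rewrite opprD addNKr is_normN sub0r is_normN (is_norm_scale Nnorm) gtr0_norm//.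
  by rewrite ger_pMr.
by move=> ?; rewrite ger_pMr.
Qed.

(** The unit ball lies between two cubes. Finiteness matters because [unit_ball_volume] is taken
    through [fine], which would send an infinite volume to 0. *)
Lemma lebesgue_norm_ball1_gt0_lty :
  (0 < lebesgue_rV (norm_ball N 0 1) < +oo)%E.
Proof.
have cube (c : R) : 0 < c ->
    lebesgue_rV [set v | forall i, (\row_(j < d) - c) ord0 i <= v ord0 i <= (\row_(j < d) c) ord0 i] =
    ((c + c) ^+ d)%:E.
  move=> c0; rewrite lebesgue_rV_box; last by move=> i; rewrite !mxE; lra.
  congr EFin; under eq_bigr do rewrite !mxE opprK.
  by rewrite prodr_const card_ord.
have mb := measurable_norm_ball 0 1.
apply/andP; split.
  have [e e0 He] := normr_ball_sub_norm_ball 0 1 ltr01.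
  have e20 : 0 < e / 2 by rewrite divr_gt0.
  apply: (@lt_le_trans _ _ ((e / 2 + e / 2) ^+ d)%:E).
    by rewrite lte_fin exprn_gt0// addr_gt0.
  rewrite -cube//; apply: le_measure; rewrite ?inE//; first exact: measurable_box.
  move=> v /= H; apply: He; split=> // i j; rewrite (ord1 i) mxE/=.
  have := H j; rewrite !mxE /ball/= sub0r normrN -ler_norml => /le_lt_trans; apply.
  by rewrite ltr_pdivrMr// ltr_pMr// ltr1n.
have [C C0 H] := normr_le_is_norm.
apply: (@le_lt_trans _ _ ((C + C) ^+ d)%:E); last by rewrite ltry.
rewrite -cube//; apply: le_measure; rewrite ?inE//; first exact: measurable_box.
move=> v; rewrite /norm_ball/= sub0r is_normN => Nv i; rewrite !mxE -ler_norml.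
apply: (@le_trans _ _ `|v|).
  rewrite [leRHS]/Num.norm/= mx_normrE.
  by apply: (le_bigmax _ (fun ij : 'I_1 * 'I_d => `|v ij.1 ij.2|) (ord0, i)).
by apply: (le_trans (H v)); rewrite ger_pMr.
Qed.

Lemma unit_ball_volume_gt0 : 0 < unit_ball_volume N.
Proof. by have := lebesgue_norm_ball1_gt0_lty; exact: fine_gt0. Qed.

Lemma lebesgue_norm_ball x r : 0 < r ->
  lebesgue_rV (norm_ball N x r) = (r ^+ d * unit_ball_volume N)%:E.
Proof.
move=> r0; have /andP[v0 vy] := lebesgue_norm_ball1_gt0_lty.
by rewrite lebesgue_norm_ball_scale// EFinM fineK// ge0_fin_numE// ltW.
Qed.

End norm_facts.

(** * Coupling with the nearest neighbours *)

Lemma probability_of_measure {R : realType} {disp} {T : measurableType disp}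
    (mu : {measure set T -> \bar R}) :
  mu setT = 1%E -> exists p : probability T R, forall A, p A = mu A.
Proof.
move=> mu1; pose nu A := mu A.
have nu_sigma : semi_sigma_additive nu by exact: measure_semi_sigma_additive.
pose H1 := isMeasure.Build _ _ _ nu (measure0 mu) (measure_ge0 mu) nu_sigma.
pose m : {measure set T -> \bar R} := HB.pack nu H1.
pose H2 := Measure_isProbability.Build _ _ _ m mu1.
by exists (HB.pack_for (probability T R) nu H1 H2).
Qed.

(** Supplies the coupling, with mass [1 / (k * n)] on each pair of a sample point and one of its
    neighbours, together with the formula for its cost. *)
Lemma uniform_probability2 {R : realType} {disp} {T : measurableType disp}
    (n k : nat) (z : nat -> nat -> T) : (0 < n)%N -> (0 < k)%N ->
  exists p : probability T R,
    (forall A, p A =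
      (((k%:R * n%:R)^-1)%:E * \sum_(i < n) \sum_(l < k) \d_(z i l) A)%E) /\
    (forall f : T -> R, measurable_fun setT f -> (forall t, 0 <= f t) ->
      (\int[p]_t (f t)%:E =
      ((k%:R * n%:R)^-1)%:E * \sum_(i < n) \sum_(l < k) (f (z i l))%:E)%E).
Proof.
move=> n0 k0; have c0 : 0 <= (k%:R * n%:R)^-1 :> R by rewrite invr_ge0 mulr_ge0.
pose mui i : {measure set T -> \bar R} := msum (fun l => dirac (z i l)) k.
pose mu : {measure set T -> \bar R} := mscale (NngNum c0) (msum mui n).
have muE A : mu A = (((k%:R * n%:R)^-1)%:E * \sum_(i < n) \sum_(l < k) \d_(z i l) A)%E by [].
have mu1 : mu setT = 1%E.
  rewrite muE; under eq_bigr do under eq_bigr do rewrite diracT.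
  under eq_bigr do rewrite sumEFin.
  rewrite sumEFin -EFinM !sumr_const !card_ord -[X in _ * X]mulr_natr mulVf//.
  by rewrite mulf_neq0// pnatr_eq0 -lt0n.
have [p pE] := probability_of_measure mu mu1.
have pmu : (p : set T -> \bar R) = mu by apply/funext => A; exact: pE.
exists p; split=> [A|f mf f0]; first by rewrite pE muE.
have mfE : measurable_fun setT (EFin \o f) by exact/measurable_EFinP.
have fE0 t : setT t -> (0 <= (EFin \o f) t)%E by rewrite /= lee_fin.
rewrite pmu ge0_integral_mscale//.
congr (_ * _)%E; rewrite ge0_integral_measure_sum//.
apply: eq_bigr => i _; rewrite ge0_integral_measure_sum//.
by apply: eq_bigr => l _; rewrite integral_dirac// diracT mul1e.
Qed.

Section nn_coupling.
Context {R : realType} {d : nat} (N : 'rV[R]_d -> R).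
Hypothesis Nnorm : is_norm N.

Lemma measurable_norm_powR_sub (q : R) :
  measurable_fun setT (fun z : 'rV[R]_d * 'rV[R]_d => N (z.1 - z.2) `^ q).
Proof.
apply: (measurableT_comp (measurable_powR q)).
apply: (measurableT_comp (measurable_norm Nnorm)).
apply: measurable_fun_rV => i.
apply: (eq_measurable_fun (fun z : 'rV[R]_d * 'rV[R]_d => z.1 ord0 i - z.2 ord0 i)).
  by move=> z _; rewrite !mxE.
apply: measurable_funB.
  by apply: (measurableT_comp (measurable_coord i)).
by apply: (measurableT_comp (measurable_coord i)).
Qed.

Lemma wasserstein_nn_le (q : R) (n k m : nat) (x x' : nat -> 'rV[R]_d) :
  0 < q -> (0 < n)%N -> (0 < k <= m)%N ->
  (wasserstein N q (empirical_measure n x) (nn_measure N k n m x x') `^ q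
   <= (n%:R^-1)%:E * \sum_(i < n) (nn_dist N k m x' (x i) `^ q)%:E)%E.
Proof.
move=> q0 n0 /andP[k0 km].
have nR0 : n%:R != 0 :> R by rewrite pnatr_eq0 -lt0n.
have kR0 : k%:R != 0 :> R by rewrite pnatr_eq0 -lt0n.
have mR0 : m%:R != 0 :> R by rewrite pnatr_eq0 -lt0n (leq_trans k0).
have [g [gE gI]] := @uniform_probability2 R _ _ n k
  (fun i l => (x i, x' (nn_index N m x' (x i) l))) n0 k0.
have gcoup : couplings (empirical_measure n x) (nn_measure N k n m x x') g.
  move=> A mA; split; rewrite gE.
    under eq_bigr do under eq_bigr do rewrite diracE.
    rewrite /empirical_measure. under eq_bigr do rewrite sumEFin.
    under [in RHS]eq_bigr do rewrite diracE.
    rewrite !sumEFin -!EFinM; congr EFin.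
    rewrite invfM mulrAC mulrC; congr (_ * _).
    rewrite mulr_sumr; apply: eq_bigr => i _.
    rewrite (eq_bigr (fun=> (x i \in A)%:R)); last first.
      by move=> l _; congr ((nat_of_bool _)%:R); apply/idP/idP; rewrite !inE/= => // -[].
    by rewrite sumr_const card_ord -[X in _ * X]mulr_natl mulKf.
  under eq_bigr do under eq_bigr do rewrite diracE.
  under eq_bigr do rewrite sumEFin.
  rewrite /nn_measure; under [in RHS]eq_bigr do rewrite diracE.
  rewrite !sumEFin -!EFinM; congr EFin.
  rewrite /nn_weight; under [in RHS]eq_bigr do rewrite -2!mulrA.
  rewrite -mulr_sumr mulKf//; under [in RHS]eq_bigr do rewrite -mulrA.
  rewrite -mulr_sumr; congr (_ * _).
  under [in RHS]eq_bigr do rewrite mulr_suml.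
  rewrite [RHS]exchange_big/=; apply: eq_bigr => i _.
  under [in RHS]eq_bigr do rewrite mulr_suml.
  rewrite [RHS]exchange_big/=; apply: eq_bigr => l _.
  (* The sum over [j] collapses to the index of this neighbour, which lies in the range of summation
     because [k <= m]. *)
  have jm : (nn_index N m x' (x i) l < m)%N.
    by apply: nn_index_lt; exact: leq_trans (ltn_ord l) km.
  rewrite (bigD1 (Ordinal jm))//= eqxx mul1r big1 ?addr0.
    by congr ((nat_of_bool _)%:R); apply/idP/idP; rewrite !inE/= => // -[].
  by move=> j; rewrite -val_eqE/= => /negbTE ->; rewrite mul0r.
(* The power [q] cancels the root [q^-1], given that the infimum is nonnegative. *)
rewrite /wasserstein -poweRrM mulVf ?gt_eqF// poweRe1; last first.
  by apply: le_ereal_inf_tmp => _ [g' _ <-]; apply: integral_ge0 => z _; rewrite lee_fin powR_ge0.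
apply: (@le_trans _ _ (\int[g]_z (N (z.1 - z.2) `^ q)%:E)%E).
  by apply: ereal_inf_lbound; exists g.
rewrite gI//=; last 2 first.
  exact: measurable_norm_powR_sub.
  by move=> z; exact: powR_ge0.
under eq_bigr do rewrite sumEFin; rewrite !sumEFin -!EFinM lee_fin.
rewrite invfM [_ / _]mulrC -mulrA ler_wpM2l ?invr_ge0// mulr_sumr.
apply: ler_sum => i _; rewrite mulrC ler_pdivrMr ?ltr0n//.
have -> : nn_dist N k m x' (x i) `^ q * k%:R =
    \sum_(l < k) nn_dist N k m x' (x i) `^ q.
  by rewrite sumr_const card_ord mulr_natr.
apply: ler_sum => l _; apply: ge0_ler_powR; rewrite ?nnegrE ?nn_dist_ge0 ?(is_norm_ge0 Nnorm) ?(ltW q0)//.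
exact: nn_dist_ge.
Qed.

End nn_coupling.

(** * Integrating out independent samples *)

Section measurable_nn_dist.
Context {R : realType} {d : nat} (N : 'rV[R]_d -> R).
Hypothesis Nnorm : is_norm N.

(** The index of a neighbour is never shown measurable: for [r >= 0] the event [nn_dist > r] says
    that a sum of indicators of measurable sets is below [k], and for [r < 0] it is everything. *)
Lemma measurable_nn_dist {disp} {T : measurableType disp} (k m : nat)
    (x : T -> 'rV[R]_d) (x' : nat -> T -> 'rV[R]_d) : (k <= m)%N ->
  measurable_fun setT x -> (forall j, measurable_fun setT (x' j)) ->
  measurable_fun setT (fun t => nn_dist N k m (fun j => x' j t) (x t)).
Proof.
move=> km mx mx'.
apply: (measurability _ (@RGenOInfty.measurableE R)) => // _ [_ [r ->] <-].
rewrite setTI.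
have [r0|r0] := ltP r 0.
  rewrite (_ : _ @^-1` _ = setT)//; apply/seteqP; split=> // t _ /=.
  by rewrite in_itv/= andbT (lt_le_trans r0)// nn_dist_ge0.
have mN j : measurable_fun setT (fun t => N (x t - x' j t)).
  apply: (measurableT_comp (measurable_norm Nnorm)).
  apply: measurable_fun_rV => i.
  apply: (eq_measurable_fun (fun t => x t ord0 i - x' j t ord0 i)).
    by move=> t _; rewrite !mxE.
  by apply: measurable_funB; exact: (measurableT_comp (measurable_coord i)).
pose A j := (fun t => N (x t - x' j t)) @^-1` `]-oo, r]%classic.
have mA j : measurable (A j).
  by rewrite -[X in measurable X]setTI; exact: mN.
have cntE t : \sum_(0 <= j < m) \1_(A j) t =
    (count (fun j => x' j t \in norm_ball N (x t) r) (iota 0 m))%:R :> R.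
  rewrite -sum1_count natr_sum [RHS]big_mkcond/= /index_iota subn0.
  apply: eq_bigr => j _; rewrite indicE.
  have -> : (t \in A j) = (x' j t \in norm_ball N (x t) r).
    by apply/idP/idP; rewrite !inE /A /norm_ball/= ?in_itv/=.
  by case: ifP.
have -> : (fun t => nn_dist N k m (fun j => x' j t) (x t)) @^-1` `]r, +oo[%classic =
    (fun t => \sum_(0 <= j < m) \1_(A j) t : R) @^-1` `]-oo, k%:R[%classic.
  have E t : (r < nn_dist N k m (fun j => x' j t) (x t)) =
      (\sum_(0 <= j < m) \1_(A j) t < k%:R :> R).
    by rewrite ltNge nn_dist_le// -ltnNge cntE ltr_nat.
  by apply/seteqP; split=> t; rewrite /preimage/= !in_itv/= andbT E.
rewrite -[X in measurable X]setTI.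
have mS : measurable_fun setT (fun t => \sum_(0 <= j < m) \1_(A j) t : R).
  by apply: measurable_sum => j; exact: measurable_indic.
exact: mS.
Qed.

End measurable_nn_dist.

Section independent_samples_fubini.
Context {R : realType} {disp disp' : measure_display}
  {Omega : measurableType disp} {T : measurableType disp'}
  {P : probability Omega R}.
Variables (X X' : nat -> {RV P >-> T}) (muX : probability T R).
Hypothesis Xiid : iid X muX.
Hypothesis indep : independent_samples X X'.

(* [X'] generates a sub-sigma-algebra of [Omega]; independence makes the law of
   [w |-> (X i w, w)] on the product of [T] and this coarser space a product. *)
Definition sample_space : Type :=
  g_sigma_algebraType (\bigcup_i preimage_set_system setT (X' i) measurable).

HB.instance Definition _ := Measurable.on sample_space.

Lemma integral_independent_samples (i : nat)
    (f : (T * sample_space)%type -> R) :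
  measurable_fun setT f -> (forall z, 0 <= f z) ->
  measurable_fun setT (fun x => \int[P]_w (f (x, w))%:E)%E /\
  (\int[P]_w (f (X i w, w))%:E = \int[muX]_x \int[P]_w (f (x, w))%:E)%E.
Proof.
move=> mf f0.
have mid : measurable_fun setT (idfun : Omega -> sample_space).
  move=> _ B mB; rewrite setTI.
  suff : <<s \bigcup_i preimage_set_system setT (X' i) measurable >> `<=` @measurable _ Omega.
    by apply.
  apply: smallest_sub; first exact: sigma_algebra_measurable.
  by move=> _ [j _ [C mC <-]]; exact: measurable_funP.
(* [P2] is the restriction of [P] to the sigma-algebra of the second sample, seen as the image under
   the identity. *)
have [P2' P2'E] := pushforward_measureP P (idfun : Omega -> sample_space) mid.
have P2'1 : P2' setT = 1%E by rewrite P2'E; exact: probability_setT.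
have [P2 P2E'] := probability_of_measure P2' P2'1.
have P2E : (P2 : set sample_space -> \bar R) = pushforward P (idfun : Omega -> sample_space).
  by apply/funext => A; rewrite P2E' P2'E.
have intP2 (g : sample_space -> \bar R) : measurable_fun setT g ->
    (forall w, (0 <= g w)%E) -> (\int[P2]_w g w = \int[P]_w g w)%E.
  by move=> mg g0; rewrite P2E ge0_integral_pushforward.
pose phi (w : Omega) : T * sample_space := (X i w, w).
have mphi : measurable_fun setT phi by exact: measurable_fun_pair.
have [Q QE'] := pushforward_measureP P phi mphi.
have QE : (Q : set _ -> \bar R) = pushforward P phi by apply/funext => A; rewrite QE'.
(* On a rectangle this is the independence hypothesis, applied to an event of [X i] and an event of
   the coarser space. *)
have prodE : forall A, measurable A -> (muX \x P2)%E A = Q A.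
  apply: product_measure_unique => A B mA mB.
  have -> : Q (A `*` B) = P (X i @^-1` A `&` B) by rewrite QE'.
  rewrite indep//; last first.
    apply: sub_sigma_algebra; exists i => //; exists A => //.
    by rewrite setTI.
  have [_ law] := Xiid; transitivity (muX A * P2 B)%E; last by [].
  by rewrite P2E' P2'E -(law i A mA).
have mfE : measurable_fun setT (EFin \o f) by exact/measurable_EFinP.
have fE0 z : (0 <= (EFin \o f) z)%E by rewrite lee_fin.
have mfx x : measurable_fun setT (fun w : sample_space => (f (x, w))%:E).
  by apply: (measurableT_comp mfE); exact: measurable_fun_pair.
have FE x : fubini_F P2 (EFin \o f) x = (\int[P]_w (f (x, w))%:E)%E.
  by rewrite /fubini_F (intP2 _ (mfx x)) => [//|w]; exact: fE0.
split.
  have -> : (fun x => (\int[P]_w (f (x, w))%:E)%E) = fubini_F P2 (EFin \o f).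
    by apply/funext => x; rewrite FE.
  exact: measurable_fun_fubini_tonelli_F.
transitivity (\int[Q]_z (f z)%:E)%E.
  by rewrite QE ge0_integral_pushforward// => z _; exact: fE0.
transitivity (\int[muX \x P2]_z (f z)%:E)%E.
  by apply: eq_measure_integral => A mA _; exact/esym/prodE.
rewrite (fubini_tonelli1 _ mfE fE0).
by apply: eq_integral => x _; rewrite FE.
Qed.

End independent_samples_fubini.

(** * Positivity of Gamma *)

(** The real-valued integral would be 0 if the integral were infinite, so finiteness comes first:
    half of the exponential absorbs the power of [t], and the rest is dominated by an exponential
    density of rate [2^-1]. Positivity is read off on [[1, 2]], where the integrand is at least
    [e ^ - 2]. *)
Lemma Gamma_gt0 {R : realType} (s : R) : 1 <= s -> 0 < Gamma s.
Proof.
move=> s1; have a0 : 0 <= s - 1 by rewrite subr_ge0.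
have [C C0 H] := powR_le_expR_scale (s - 1) a0.
have h0 : 0 < 2^-1 :> R by rewrite invr_gt0.
pose f t : R := t `^ (s - 1) * expR (- t).
have f0 t : 0 <= f t by rewrite mulr_ge0 ?powR_ge0 ?expR_ge0.
have mf (D : set R) : measurable_fun D (EFin \o f).
  apply/measurable_EFinP/measurable_funTS; apply: measurable_funM.
    exact: measurable_powR.
  by apply: measurableT_comp => //; exact: measurable_oppr.
pose K := 2 * (C / 2^-1 `^ (s - 1)).
have K0 : 0 <= K by rewrite mulr_ge0// divr_ge0 ?powR_ge0// ltW.
have fle t : 0 < t -> f t <= K * exponential_pdf 2^-1 t.
  move=> t0; rewrite exponential_pdfE ?(ltW t0)// /f /K.
  have -> : expR (- t) = expR (- (2^-1 * t)) * expR (- 2^-1 * t).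
    by rewrite -expRD; congr expR; lra.
  rewrite mulrA [leRHS](_ : _ = C / 2^-1 `^ (s - 1) * expR (- 2^-1 * t)); last first.
    by field; rewrite gt_eqF// powR_gt0.
  by rewrite ler_wpM2r ?expR_ge0// H// ltW.
have fin : (\int[lebesgue_measure]_(t in `]0%R, +oo[) (f t)%:E < +oo)%E.
  apply: (@le_lt_trans _ _ (\int[lebesgue_measure]_t (K%:E * (exponential_pdf 2^-1 t)%:E))%E).
    apply: (@le_trans _ _ (\int[lebesgue_measure]_(t in `]0%R, +oo[) (K%:E * (exponential_pdf 2^-1 t)%:E))%E).
      apply: ge0_le_integral => //=.
      - by move=> t _; rewrite lee_fin.
      - exact: mf.
      - apply/measurable_EFinP/measurable_funTS; apply: measurable_funM => //.
        exact: measurable_exponential_pdf.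
      - by move=> t; rewrite in_itv/= andbT -EFinM lee_fin => /fle.
    apply: ge0_subset_integral => //.
    - apply/measurable_EFinP; apply: measurable_funM => //.
      exact: measurable_exponential_pdf.
    - by move=> t _; rewrite -EFinM lee_fin mulr_ge0// exponential_pdf_ge0// ltW.
  rewrite ge0_integralZl//.
  - by rewrite integral_exponential_pdf// mule1 ltry.
  - by apply/measurable_EFinP; exact: measurable_exponential_pdf.
  - by move=> t _; rewrite lee_fin exponential_pdf_ge0// ltW.
rewrite /Gamma /Rintegral fine_gt0// fin andbT.
apply: (@lt_le_trans _ _ (\int[lebesgue_measure]_(t in `[1%R, 2%R]) (f t)%:E)%E); last first.
  apply: ge0_subset_integral => //.
  - exact: mf.
  - by move=> t _; rewrite lee_fin.
  - by move=> t /=; rewrite !in_itv/= andbT => /andP[t1 _]; exact: lt_le_trans t1.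
apply: (@lt_le_trans _ _ (\int[lebesgue_measure]_(t in `[1%R, 2%R]) (expR (- 2))%:E)%E).
  rewrite integral_cst//= lebesgue_measure_itv/= lte_fin ltr1n -EFinB -EFinM lte_fin.
  by rewrite mulr_gt0 ?expR_gt0// subr_gt0 ltr1n.
apply: ge0_le_integral => //.
- exact: mf.
- move=> t /=; rewrite in_itv/= => /andP[t1 t2]; rewrite lee_fin /f.
  apply: (@le_trans _ _ (1 * expR (- t))); first by rewrite mul1r ler_expR lerN2.
  rewrite ler_wpM2r ?expR_ge0//.
  by have := ge0_ler_powR a0 (ler01 : 0 <= 1) (le_trans ler01 t1 : 0 <= t) t1; rewrite powR1.
Qed.

(** * Supports, moments and densities *)

(** Every point outside the support lies in a null ball with rational centre and radius, and there
    are countably many of these. In the enumeration [F], codes of other balls and codes that decode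
    to nothing give the empty set. *)
Lemma measure_setC_of_msupport {R : realType} {d : nat} (N : 'rV[R]_d -> R)
    (mu : probability 'rV[R]_d R) (U : set 'rV[R]_d) :
  is_norm N -> open U -> msupport N mu `<=` U -> mu (~` U) = 0%E.
Proof.
move=> Nnorm oU suppU.
pose B (qe : 'rV[rat]_d * rat) := ball (map_mx ratr qe.1 : 'rV[R]_d) (ratr qe.2).
have mB qe : measurable (B qe) by apply: open_measurable_rV; exact: ball_open.
pose F n := if @unpickle ('rV[rat]_d * rat)%type n is Some qe then
  if mu (B qe) == 0%E then B qe else set0 else set0.
have negF : mu.-negligible (\bigcup_n F n).
  apply: negligible_bigcup => n; rewrite /F.
  case: unpickle => [qe|]; last exact: negligible_set0.
  by case: ifPn => [/eqP h|_]; [exact/negligibleP|exact: negligible_set0].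
apply/negligibleP; first by apply: measurableC; exact: open_measurable_rV.
apply: negligibleS negF => x Ux.
have /existsNP[r /not_implyP[r0 /negP]] : ~ msupport N mu x by move/suppU.
rewrite -leNgt => muB.
have [e e0 He] := normr_ball_sub_norm_ball Nnorm x r r0.
have : ball x e x by exact: ballxx.
rewrite (open_rV_rational_boxes (ball_open x e)) => -[qe /= qe_sub xqe].
exists (pickle qe) => //; rewrite /F pickleK ifT//.
rewrite -measure_le0 (le_trans _ muB)//.
apply: le_measure; rewrite ?inE//; first exact: (measurable_norm_ball Nnorm).
by move=> y /qe_sub/He.
Qed.

(* Needed because [w |-> wasserstein ...] is an infimum over all couplings, whose
   measurability is not available. *)
Lemma ge0_le_integral_nonmeasurable {R : realType} {disp} {T : measurableType disp}
    (mu : {measure set T -> \bar R}) (f g : T -> \bar R) :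
  (forall x, 0 <= f x)%E -> (forall x, f x <= g x)%E ->
  (\int[mu]_x f x <= \int[mu]_x g x)%E.
Proof.
move=> f0 fg; rewrite !ge0_integralTE//; last by move=> x; exact: le_trans (fg x).
apply: ereal_sup_le => _ /= [h hf <-]; exists h => // x.
exact: le_trans (fg x).
Qed.

(** Markov's inequality for the minimum: by independence, all [m0] points have norm above [r / 2]
    with probability [G ^ m0]. A point outside [B(x, r)] is such a point once [2 * N x <= r]. The 1
    added to [M] keeps it positive when the moment vanishes. *)
Lemma norm_tail_of_min_moment {R : realType} {d : nat} (N : 'rV[R]_d -> R)
    {disp} {Omega : measurableType disp} {P : probability Omega R}
    (X' : nat -> {RV P >-> 'rV[R]_d}) (muX' : probability 'rV[R]_d R) (m0 : nat) :
  is_norm N -> iid X' muX' ->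
  (\int[P]_w (\big[Order.min/+oo]_(j < m0) (N (X' j w))%:E) < +oo)%E ->
  exists2 M : R, 0 < M & forall x r, 0 < r -> 2 * N x <= r ->
    (1 - fine (muX' (norm_ball N x r))) ^+ m0 <= M / r.
Proof.
move=> Nnorm [indep law].
set I := (X in (X < +oo)%E -> _) => Ioo.
have min0 w : (0 <= \big[Order.min/+oo]_(j < m0) (N (X' j w))%:E)%E.
  apply: (big_ind (fun x => 0 <= x)%E) => // [x y x0 y0|j _].
    by rewrite le_min x0.
  by rewrite lee_fin (is_norm_ge0 Nnorm).
have I0 : (0 <= I)%E by apply: integral_ge0 => w _; exact: min0.
pose C := fine I.
have IC : I = C%:E by rewrite fineK// ge0_fin_numE.
have C0 : 0 <= C by exact: fine_ge0.
exists (2 * C + 1); first by rewrite ltr_wpDl// mulr_ge0.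
move=> x r r0 xr; have mb := measurable_norm_ball Nnorm x r.
pose S := [set y : 'rV[R]_d | r / 2 < N y].
have mS : measurable S.
  rewrite (_ : S = N @^-1` `]r / 2, +oo[%classic).
    by rewrite -[X in measurable X]setTI; exact: measurable_norm.
  by apply/seteqP; split=> y; rewrite /S/= in_itv/= andbT.
pose G := fine (muX' S).
have GE : muX' S = G%:E by rewrite fineK// fin_num_measure.
have FG : 1 - fine (muX' (norm_ball N x r)) <= G.
  rewrite -lee_fin -GE EFinB fineK ?fin_num_measure// -probability_setC//.
  apply: le_measure; rewrite ?inE//; first exact: measurableC.
  move=> y; rewrite /norm_ball /S/= => /negP; rewrite -ltNge => xyr.
  have := is_norm_triangle Nnorm x (- y); rewrite (is_normN Nnorm).
  lra.
have F1 : 0 <= 1 - fine (muX' (norm_ball N x r)).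
  by rewrite subr_ge0 -lee_fin fineK ?fin_num_measure// probability_le1.
apply: (@le_trans _ _ (G ^+ m0)).
  by rewrite lerXn2r// nnegrE// (le_trans F1).
pose E := \big[setI/setT]_(j <- iota 0 m0) (X' j @^-1` S).
have mE : measurable E.
  apply: bigsetI_measurable => j _; exact: measurable_funPTI.
have PE : P E = (G ^+ m0)%:E.
  rewrite /E (indep _ (fun=> S)) ?iota_uniq//.
  rewrite (eq_bigr (fun=> G%:E)); last by move=> j _; rewrite -GE -(law j).
  by rewrite prodEFin -[in LHS](subn0 m0) -/(index_iota 0 m0) big_mkord prodr_const card_ord.
have : ((r / 2)%:E * P E <= C%:E)%E.
  rewrite -IC -integral_cst//= integral_mkcond.
  apply: ge0_le_integral_nonmeasurable => w; rewrite patchE; case: ifPn => //.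
    by move=> _; rewrite lee_fin divr_ge0// ltW.
  rewrite inE /E -bigcap_seq => wE.
  apply: (big_ind (fun t => (r / 2)%:E <= t)%E) => [|a b ra rb|j _].
  - by rewrite leey.
  - by rewrite le_min ra.
  - rewrite lee_fin ltW//; apply: (wE j).
    by rewrite /= mem_iota add0n ltn_ord.
rewrite PE -EFinM lee_fin => h.
rewrite ler_pdivlMr//; lra.
Qed.

(** By continuity the density is at least half its value at [x] on a small ball around [x]. The
    factor [2^-1] is universal; only the radius [rho] depends on the point. *)
Lemma density_ball_lower_bound {R : realType} {d : nat} (N : 'rV[R]_d -> R)
    (mu : probability 'rV[R]_d R) (U : set 'rV[R]_d) (p : 'rV[R]_d -> R) x :
  is_norm N -> open U -> density_on mu U p -> {within U, continuous p} ->
  U x -> 0 < p x ->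
  exists2 rho : R, 0 < rho & forall r, 0 < r <= rho ->
    2^-1 * p x * unit_ball_volume N * r ^+ d <= fine (mu (norm_ball N x r)).
Proof.
move=> Nnorm oU [mp p0 pE] cp Ux px.
have cpx : p @ x --> p x.
  by move: cp; rewrite continuous_open_subspace// => cp; apply: cp; rewrite inE.
have near_x : \forall y \near x, U y /\ p x / 2 <= p y.
  apply: filterI; first exact: open_nbhs_nbhs.
  have pxl : p x / 2 < p x by rewrite ltr_pdivrMr// ltr_pMr// ltr1n.
  by apply: filterS (@cvgr_gt _ _ _ _ p (p x) cpx _ pxl) => y /ltW.
have /nbhs_ballP[e /= e0 xe] := near_x.
have [rho rho0 rhoe] := norm_ball_sub_normr_ball Nnorm x e e0.
exists rho => // r /andP[r0 rrho].
have mb := measurable_norm_ball Nnorm x r.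
have bsub y : norm_ball N x r y -> U y /\ p x / 2 <= p y.
  move=> xy; apply: xe; apply: rhoe; exact: le_trans rrho.
rewrite -lee_fin fineK ?fin_num_measure//.
have -> : norm_ball N x r = norm_ball N x r `&` U.
  by apply/esym/setIidPl => y /bsub[].
rewrite pE//.
have -> : 2^-1 * p x * unit_ball_volume N * r ^+ d =
    p x / 2 * (r ^+ d * unit_ball_volume N) by ring.
rewrite EFinM -(lebesgue_norm_ball Nnorm x r r0) -integral_cst//.
apply: ge0_le_integral => //.
- by move=> y _; rewrite lee_fin divr_ge0// ltW.
- by apply/measurable_EFinP; exact: measurable_funTS.
- by move=> y /bsub[_]; rewrite lee_fin.
Qed.

(** * Moments of the nearest-neighbour distance *)

Definition nn_moment {R : realType} {d : nat} (N : 'rV[R]_d -> R)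
    {disp : measure_display} {Omega : measurableType disp}
    {P : probability Omega R} (X' : nat -> {RV P >-> 'rV[R]_d})
    (q : R) (k m : nat) (x : 'rV[R]_d) : \bar R :=
  (\int[P]_w (nn_dist N k m (fun j => X' j w) x `^ q)%:E)%E.

(** The three terms come from radii up to [rho], from the gap between [rho] and [rR], and from radii
    beyond [rR]. [C] depends only on [d], [q] and [eta]; [K] may depend on the law of [X'] but
    neither on [x] nor on [m]. The conditions on [rR] are what the far tail bound requires at every
    radius from [rR] on. *)
Lemma nn_moment_bound {R : realType} (d : nat) (q eta : R) :
  (0 < d)%N -> 0 <= q -> 0 < eta ->
  exists2 C : R, 0 < C &
  forall (N : 'rV[R]_d -> R) (disp : measure_display)
    (Omega : measurableType disp) (P : probability Omega R)
    (X' : nat -> {RV P >-> 'rV[R]_d}) (muX' : probability 'rV[R]_d R)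
    (m0 Q : nat) (M : R),
  is_norm N -> iid X' muX' -> (0 < m0)%N -> 0 < M -> q + 1 <= Q%:R ->
  (forall x r, 0 < r -> 2 * N x <= r ->
     (1 - fine (muX' (norm_ball N x r))) ^+ m0 <= M / r) ->
  exists2 K : R, 0 <= K &
  forall (k m : nat) (x : 'rV[R]_d) (p rho rR : R),
    (0 < k)%N -> (3 * k <= m)%N -> (m0 * Q + k <= m)%N ->
    0 < p -> 0 < rho -> 1 <= rR -> 2 * N x <= rR ->
    M / expR (- 3) ^+ m0 <= rR ->
    (forall r, 0 < r <= rho ->
       eta * p * unit_ball_volume N * r ^+ d <= fine (muX' (norm_ball N x r))) ->
    (((m%:R / k%:R) `^ (q / d%:R))%:E * nn_moment N X' q k m x <=
     (C / (p * unit_ball_volume N) `^ (q / d%:R)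
      + (m%:R / k%:R) `^ (q / d%:R) *
        expR (- (eta * p * unit_ball_volume N * rho ^+ d / 4 * (m%:R / k%:R)))
        * (expR 1 * rR `^ q)
      + (m%:R / k%:R) `^ (q / d%:R) * expR (- m%:R) * K)%:E)%E.
Proof.
move=> d_gt0 q0 eta0; have [C C0 HC] := moment_bound q eta q0 eta0.
exists C => // N disp Omega P X' muX' m0 Q M Nnorm X'iid m0_gt0 M_gt0 qQ tailM.
set v := unit_ball_volume N.
pose K0 := M ^+ Q * expR 3 ^+ (m0 * Q).
have K00 : 0 <= K0 by rewrite mulr_ge0 ?exprn_ge0 ?expR_ge0// ltW.
exists (2 * (2 `^ q * K0)); first by apply: mulr_ge0 => //; apply: mulr_ge0 => //; exact: powR_ge0.
move=> k m x p rho rR k0 km mQ p0 rho0 rR1 xR MR near.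
have v0 : 0 < v := unit_ball_volume_gt0 Nnorm.
have kR0 : 0 < k%:R :> R by rewrite ltr0n.
have km' : (k <= m)%N by exact: leq_trans (leq_pmull k (isT : 0 < 3)%N) km.
have mR0 : 0 < m%:R :> R by rewrite ltr0n (leq_trans k0).
have dR0 : 0 < d%:R :> R by rewrite ltr0n.
set y := m%:R / k%:R; have y0 : 0 < y by rewrite divr_gt0.
set lam := eta * p * v; have lam0 : 0 < lam by rewrite mulr_gt0// mulr_gt0.
have ypv0 : 0 < y * (p * v) by rewrite mulr_gt0// mulr_gt0.
(* [s] is the radius for which [y * p * v * s ^ d = 1]. *)
pose s := (y * (p * v)) `^ (- d%:R^-1).
have s0 : 0 < s by rewrite powR_gt0.
have sd : y * lam * s ^+ d = eta.
  rewrite -powR_mulrn ?(ltW s0)// -powRrM mulNr mulVf ?gt_eqF// powRN powRr1 ?(ltW ypv0)//.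
  by rewrite /lam; field; rewrite !gt_eqF.
have rR0 : 0 < rR by exact: lt_le_trans rR1.
have mb := measurable_norm_ball Nnorm.
have mD : measurable_fun setT (fun w => nn_dist N k m (fun j => X' j w) x).
  apply: (measurable_nn_dist N Nnorm k m (fun=> x) (fun j w => X' j w) km').
    exact: measurable_cst.
  by move=> j; exact: (@measurable_funP _ _ _ _ setT (X' j)).
have nearP r : 0 < r <= rho -> (P [set w | (r < nn_dist N k m (fun j => X' j w) x)%R]
    <= (expR 1 * expR (- (y * lam * r ^+ d / 4)))%:E)%E.
  move=> /[dup] /near F_ge /andP[r0 rrho].
  apply: (le_trans (nn_dist_tail_exp N X' muX' X'iid mb k m x r _ (ltW r0))).
    by rewrite k0.
  rewrite lee_fin ler_pM2l ?expR_gt0// ler_expR lerN2 ler_pM2r ?invr_gt0//.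
  by rewrite -mulrA ler_pM2l.
have farP r : rR <= r -> (P [set w | (r < nn_dist N k m (fun j => X' j w) x)%R]
    <= (K0 * expR (- m%:R) / r ^+ Q)%:E)%E.
  move=> rRr; have r0 : 0 < r by exact: lt_le_trans rRr.
  apply: (nn_dist_tail_far N X' muX' X'iid mb k m m0 Q x r M) => //.
    rewrite ler_pdivrMr// mulrC -ler_pdivrMr ?exprn_gt0 ?expR_gt0//.
    exact: le_trans rRr.
  by apply: tailM => //; exact: le_trans rRr.
have K0m : 0 <= K0 * expR (- m%:R) by rewrite mulr_ge0// expR_ge0.
have := HC _ _ P _ d Q y lam s rho rR _ mD (fun w => nn_dist_ge0 N k m _ x) d_gt0
  qQ y0 lam0 s0 rho0 rR1 K0m sd nearP farP.
have ya0 : (0 <= (y `^ (q / d%:R))%:E)%E by rewrite lee_fin powR_ge0.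
move=> /(lee_wpmul2l ya0) h; apply: (le_trans h).
rewrite -EFinM lee_fin.
have ys : y `^ (q / d%:R) * s `^ q = ((p * v) `^ (q / d%:R))^-1.
  have pv0 : 0 < p * v by rewrite mulr_gt0.
  rewrite -powRrM mulNr powRN [_^-1 * q]mulrC (powRM (q / d%:R) (ltW y0) (ltW pv0)).
  by field; rewrite !gt_eqF ?powR_gt0.
rewrite 2!mulrDr [_ * (C * _)]mulrCA ys -/(C / _).
have -> : eta * p * v * rho ^+ d / 4 * y = y * lam * rho ^+ d / 4.
  by rewrite /lam; ring.
rewrite le_eqVlt; apply/orP; left; apply/eqP; ring.
Qed.

(** Taking one more power out of the exponential leaves an explicit rate [1 / y], so that a mere
    lower bound on [y] makes the product small. *)
Lemma powR_expR_le_inv {R : realType} (a b : R) : 0 <= a -> 0 < b ->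
  exists2 E : R, 0 <= E & forall y, 0 < y -> y `^ a * expR (- (b * y)) <= E / y.
Proof.
move=> a0 b0; have [C C0 H] := powR_le_expR_scale (a + 1) (addr_ge0 a0 ler01).
exists (C / b `^ (a + 1)); first by rewrite divr_ge0 ?powR_ge0// ltW.
move=> y y0; rewrite ler_pdivlMr//; apply: le_trans (H b y b0 (ltW y0)).
rewrite powRD; last by rewrite (gt_eqF y0) implybT.
by rewrite powRr1 ?(ltW y0)// mulrAC.
Qed.

Lemma powR_1D_le {R : realType} (q t : R) : 0 <= q -> 0 <= t ->
  (1 + t) `^ q <= 2 `^ q * (1 + t `^ q).
Proof.
move=> q0 t0; have [t1|t1] := leP t 1.
  apply: (@le_trans _ _ (2 `^ q)); last by rewrite ler_peMr ?powR_ge0// lerDl powR_ge0.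
  by apply: ge0_ler_powR; rewrite ?nnegrE//; lra.
apply: (@le_trans _ _ ((2 * t) `^ q)).
  by apply: ge0_ler_powR; rewrite ?nnegrE//; lra.
by rewrite powRM// ler_wpM2l ?powR_ge0// lerDr.
Qed.

Lemma near_ratio_ge {R : realType} (k : nat -> nat) (Y : R) (B : nat) :
  (forall m, (1 <= m)%N -> (1 <= k m <= m)%N) ->
  (k m)%:R / m%:R @[m --> \oo] --> (0 : R) ->
  \forall m \near \oo, [/\ (0 < k m)%N, (3 * k m <= m)%N, (B + k m <= m)%N &
    Y <= m%:R / (k m)%:R].
Proof.
move=> kP kcvg; pose Z := Num.max Y 3.
have Z0 : 0 < Z by rewrite lt_max ltr0n orbT.
have Zi : 0 < Z^-1 by rewrite invr_gt0.
move/cvgrPdist_le : kcvg => /(_ _ Zi) kZ.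
(* Once [3 * k m <= m], the bound [2 * B < m] gives [B + k m <= m]. *)
have mB := nbhs_infty_ge (1 + 2 * B)%N.
apply: filterS2 mB kZ => m /= mB.
have m1 : (1 <= m)%N by lia.
have /andP[k0 km] := kP m m1.
have mR0 : 0 < m%:R :> R by rewrite ltr0n.
have kR0 : 0 < (k m)%:R :> R by rewrite ltr0n.
rewrite sub0r normrN ger0_norm; last by rewrite divr_ge0// ltW.
rewrite ler_pdivrMr// mulrC -[leRHS]/(m%:R / Z) ler_pdivlMr// mulrC => Zm.
have k3 : (3 * k m <= m)%N.
  rewrite -(ler_nat R) natrM; apply: le_trans Zm.
  by rewrite ler_wpM2r// le_max lexx orbT.
split => //; first by lia.
rewrite ler_pdivlMr//; apply: le_trans Zm.
by rewrite ler_wpM2r// le_max lexx.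
Qed.

(** For fixed [x] the gap and far terms are [O(k / m)]: the first by its exponential in [m / k], the
    second because [m / k <= m]. They end below the main term, whence the factor 2 in the
    constant. *)
Lemma nn_moment_eventually_le {R : realType} (d : nat) (q : R) :
  (0 < d)%N -> 0 <= q ->
  exists2 C : R, 0 < C &
  forall (N : 'rV[R]_d -> R) (disp : measure_display)
    (Omega : measurableType disp) (P : probability Omega R)
    (X' : nat -> {RV P >-> 'rV[R]_d}) (muX' : probability 'rV[R]_d R)
    (m0 : nat) (M : R) (k : nat -> nat) (x : 'rV[R]_d) (p rho : R),
  is_norm N -> iid X' muX' -> (0 < m0)%N -> 0 < M ->
  (forall x r, 0 < r -> 2 * N x <= r ->
     (1 - fine (muX' (norm_ball N x r))) ^+ m0 <= M / r) ->
  (forall m, (1 <= m)%N -> (1 <= k m <= m)%N) ->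
  (k m)%:R / m%:R @[m --> \oo] --> (0 : R) ->
  0 < p -> 0 < rho ->
  (forall r, 0 < r <= rho ->
     2^-1 * p * unit_ball_volume N * r ^+ d <= fine (muX' (norm_ball N x r))) ->
  \forall m \near \oo,
    (((m%:R / (k m)%:R) `^ (q / d%:R))%:E * nn_moment N X' q (k m) m x <=
     (C / (p * unit_ball_volume N) `^ (q / d%:R))%:E)%E.
Proof.
move=> d0 q0; have h0 : 0 < (2^-1 : R) by rewrite invr_gt0.
have [C C0 HC] := nn_moment_bound d q 2^-1 d0 q0 h0.
exists (2 * C); first by rewrite mulr_gt0.
move=> N disp Omega P X' muX' m0 M k x p rho Nnorm X'iid m00 M0 tailM kP kcvg p0 rho0 near.
have v0 := unit_ball_volume_gt0 Nnorm; set v := unit_ball_volume N in v0 near *.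
pose Q := (Num.truncn (q + 1)).+1.
have qQ : q + 1 <= Q%:R by apply/ltW/truncnS_gt.
have [K K0 HK] := HC N disp Omega P X' muX' m0 Q M Nnorm X'iid m00 M0 qQ tailM.
have a0 : 0 <= q / d%:R by rewrite divr_ge0.
set a := q / d%:R in a0 HK *.
have b0 : 0 < 2^-1 * p * v * rho ^+ d / 4.
  by rewrite divr_gt0// !mulr_gt0// exprn_gt0.
set b := 2^-1 * p * v * rho ^+ d / 4 in b0.
have [E1 E10 HE1] := powR_expR_le_inv a b a0 b0.
have [E2 E20 HE2] := powR_expR_le_inv a 1 a0 ltr01.
have N0 := is_norm_ge0 Nnorm x.
pose M' := M / expR (- 3) ^+ m0.
have M'0 : 0 <= M' by rewrite divr_ge0 ?exprn_ge0 ?expR_ge0// ltW.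
pose rR := 1 + 2 * N x + M'.
pose A := expR 1 * rR `^ q.
have A0 : 0 <= A by rewrite mulr_ge0 ?expR_ge0 ?powR_ge0.
have pv0 : 0 < (p * v) `^ a by rewrite powR_gt0// mulr_gt0.
(* From this value of [m / k] on, the gap and far terms together are at most the main term. *)
pose Y := (E1 * A + E2 * K) / (C / (p * v) `^ a).
have := near_ratio_ge k Y (m0 * Q) kP kcvg.
apply: filterS => m [k0 km mQ Ym].
have rR1 : 1 <= rR by rewrite /rR; lra.
have rRx : 2 * N x <= rR by rewrite /rR; lra.
have rRM : M / expR (- 3) ^+ m0 <= rR by rewrite -/M' /rR; lra.
apply: (le_trans (HK (k m) m x p rho rR k0 km mQ p0 rho0 rR1 rRx rRM near)).
have kR1 : 1 <= (k m)%:R :> R by rewrite ler1n.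
have kR0 : 0 < (k m)%:R :> R by exact: lt_le_trans kR1.
have mR0 : 0 < m%:R :> R.
  by rewrite ltr0n (leq_trans k0)// (leq_trans _ km)// leq_pmull.
have ym : m%:R / (k m)%:R <= m%:R :> R by rewrite ler_pdivrMr// ler_peMr// ltW.
set y := m%:R / (k m)%:R in Ym ym *.
have y0 : 0 < y by rewrite divr_gt0.
rewrite lee_fin -/v -/b -/A.
have -> : 2 * C / (p * v) `^ a = C / (p * v) `^ a + C / (p * v) `^ a by ring.
rewrite -addrA lerD2l.
have T1 : y `^ a * expR (- (b * y)) * A <= E1 / y * A.
  by rewrite ler_wpM2r// HE1.
have T2 : y `^ a * expR (- m%:R) * K <= E2 / y * K.
  rewrite ler_wpM2r//; apply: le_trans (HE2 y y0).
  by rewrite ler_wpM2l ?powR_ge0// ler_expR lerN2 mul1r.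
apply: (le_trans (lerD T1 T2)).
have -> : E1 / y * A + E2 / y * K = (E1 * A + E2 * K) / y.
  by field; rewrite gt_eqF.
by rewrite ler_pdivrMr// [leRHS]mulrC -ler_pdivrMr ?divr_gt0.
Qed.

(** Here the threshold on [m] must not depend on [x], so the gap term cannot be made small. Instead
    [y ^ a * e ^ (- beta * p * y)] is bounded by a multiple of [1 / p ^ a] for every [y], and [rR],
    affine in [N x], contributes a multiple of [1 + N x ^ q]. Their product is the integrand of
    hypothesis (c). *)
Lemma nn_moment_dominated {R : realType} {d : nat} (q kappa rho M : R) (m0 : nat)
    (N : 'rV[R]_d -> R) {disp : measure_display}
    {Omega : measurableType disp} {P : probability Omega R}
    (X' : nat -> {RV P >-> 'rV[R]_d}) (muX' : probability 'rV[R]_d R)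
    (k : nat -> nat) :
  (0 < d)%N -> 0 <= q -> 0 < kappa -> 0 < rho ->
  is_norm N -> iid X' muX' -> (0 < m0)%N -> 0 < M ->
  (forall x r, 0 < r -> 2 * N x <= r ->
     (1 - fine (muX' (norm_ball N x r))) ^+ m0 <= M / r) ->
  (forall m, (1 <= m)%N -> (1 <= k m <= m)%N) ->
  (k m)%:R / m%:R @[m --> \oo] --> (0 : R) ->
  exists H1 H2 : R, [/\ 0 <= H1, 0 <= H2 & \forall m \near \oo,
    forall x p, 0 < p ->
    (forall r, 0 < r <= rho ->
       kappa * p * unit_ball_volume N * r ^+ d <= fine (muX' (norm_ball N x r))) ->
    (((m%:R / (k m)%:R) `^ (q / d%:R))%:E * nn_moment N X' q (k m) m x <=
     (H1 * ((1 + N x `^ q) / p `^ (q / d%:R)) + H2)%:E)%E].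
Proof.
move=> d0 q0 kappa0 rho0 Nnorm X'iid m00 M0 tailM kP kcvg.
have [C C0 HC] := nn_moment_bound d q kappa d0 q0 kappa0.
have v0 := unit_ball_volume_gt0 Nnorm; set v := unit_ball_volume N in v0 *.
pose Q := (Num.truncn (q + 1)).+1.
have qQ : q + 1 <= Q%:R by apply/ltW/truncnS_gt.
have [K K0 HK] := HC N disp Omega P X' muX' m0 Q M Nnorm X'iid m00 M0 qQ tailM.
have a0 : 0 <= q / d%:R by rewrite divr_ge0.
set a := q / d%:R in a0 HK *.
have [E E0 HE] := powR_le_expR_scale a a0.
pose beta := kappa * v * rho ^+ d / 4.
have beta0 : 0 < beta by rewrite divr_gt0// mulr_gt0 ?exprn_gt0// mulr_gt0.
pose M' := M / expR (- 3) ^+ m0.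
have M'0 : 0 <= M' by rewrite divr_ge0 ?exprn_ge0 ?expR_ge0// ltW.
pose L := expR 1 * ((2 + M') `^ q * 2 `^ q).
have L0 : 0 <= L by apply: mulr_ge0; [exact: expR_ge0|rewrite mulr_ge0 ?powR_ge0].
have va0 : 0 < v `^ a by rewrite powR_gt0.
have ba0 : 0 < beta `^ a by rewrite powR_gt0.
exists (C / v `^ a + E / beta `^ a * L), (E * K); split.
- apply: addr_ge0; first by apply: divr_ge0; exact: ltW.
  by apply: mulr_ge0 => //; apply: divr_ge0; exact: ltW.
- by rewrite mulr_ge0// ltW.
have := near_ratio_ge k 0 (m0 * Q) kP kcvg.
apply: filterS => m [k0 km mQ _] x p p0 near.
have N0 := is_norm_ge0 Nnorm x.
pose rR := 1 + 2 * N x + M'.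
have rR1 : 1 <= rR by rewrite /rR; lra.
have rRx : 2 * N x <= rR by rewrite /rR; lra.
have rRM : M / expR (- 3) ^+ m0 <= rR by rewrite -/M' /rR; lra.
apply: (le_trans (HK (k m) m x p rho rR k0 km mQ p0 rho0 rR1 rRx rRM near)).
have kR1 : 1 <= (k m)%:R :> R by rewrite ler1n.
have kR0 : 0 < (k m)%:R :> R by exact: lt_le_trans kR1.
have mR0 : 0 < m%:R :> R.
  by rewrite ltr0n (leq_trans k0)// (leq_trans _ km)// leq_pmull.
have ym : m%:R / (k m)%:R <= m%:R :> R by rewrite ler_pdivrMr// ler_peMr// ltW.
set y := m%:R / (k m)%:R in ym *.
have y0 : 0 < y by rewrite divr_gt0.
have pa0 : 0 < p `^ a by rewrite powR_gt0.
set t := N x `^ q; have t0 : 0 <= t by exact: powR_ge0.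
rewrite lee_fin -/v.
have T0 : C / (p * v) `^ a <= C / v `^ a * ((1 + t) / p `^ a).
  rewrite powRM ?(ltW p0) ?(ltW v0)// [leRHS](_ : _ = C / (p `^ a * v `^ a) * (1 + t)).
    by rewrite ler_peMr ?lerDl// divr_ge0 ?mulr_ge0 ?(ltW C0) ?(ltW pa0) ?(ltW va0).
  by field; rewrite !gt_eqF.
have rRq : rR `^ q <= (2 + M') `^ q * 2 `^ q * (1 + t).
  apply: (@le_trans _ _ (((2 + M') * (1 + N x)) `^ q)).
    apply: ge0_ler_powR; rewrite ?nnegrE//.
    - by apply: le_trans rR1.
    - by rewrite mulr_ge0//; lra.
    - rewrite /rR; have : 0 <= M' * N x by rewrite mulr_ge0.
      lra.
  rewrite powRM; [|lra|lra].
  by rewrite -mulrA ler_wpM2l ?powR_ge0// powR_1D_le.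
have T1 : y `^ a * expR (- (kappa * p * v * rho ^+ d / 4 * y)) * (expR 1 * rR `^ q)
    <= E / beta `^ a * L * ((1 + t) / p `^ a).
  have -> : kappa * p * v * rho ^+ d / 4 = beta * p by rewrite /beta; ring.
  rewrite [leRHS](_ : _ = E / (beta * p) `^ a * (L * (1 + t))); last first.
    rewrite (powRM a (ltW beta0) (ltW p0)).
    by field; rewrite !gt_eqF.
  apply: ler_pM.
  - by rewrite mulr_ge0 ?powR_ge0 ?expR_ge0.
  - by rewrite mulr_ge0 ?powR_ge0 ?expR_ge0.
  - by apply: HE; [rewrite mulr_gt0|exact: ltW].
  - by rewrite /L -mulrA ler_wpM2l ?expR_ge0.
have T2 : y `^ a * expR (- m%:R) * K <= E * K.
  rewrite ler_wpM2r//.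
  have := HE 1 y ltr01 (ltW y0); rewrite powR1 divr1; apply: le_trans.
  by rewrite ler_wpM2l ?powR_ge0// ler_expR lerN2 mul1r.
rewrite [X in _ <= X + _]mulrDl.
by apply: lerD T2; apply: lerD T1.
Qed.

(** * Convergence of the expected cost *)

Section nn_moment_integral.
Context {R : realType} {d : nat} (N : 'rV[R]_d -> R).
Hypothesis Nnorm : is_norm N.
Context {disp : measure_display} {Omega : measurableType disp}
  {P : probability Omega R}.
Variables (X X' : nat -> {RV P >-> 'rV[R]_d}) (muX : probability 'rV[R]_d R).
Hypotheses (Xiid : iid X muX) (indep : independent_samples X X').

Lemma integral_nn_dist (q : R) (k m i : nat) : (k <= m)%N ->
  measurable_fun setT (nn_moment N X' q k m) /\
  (\int[P]_w (nn_dist N k m (fun j => X' j w) (X i w) `^ q)%:E =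
   \int[muX]_x nn_moment N X' q k m x)%E.
Proof.
move=> km.
have mX' j : measurable_fun setT (X' j : sample_space X' -> 'rV[R]_d).
  move=> _ B mB; apply: sub_sigma_algebra; exists j => //; exists B => //.
pose f (z : 'rV[R]_d * sample_space X') :=
  nn_dist N k m (fun j => X' j z.2) z.1 `^ q.
apply: (@integral_independent_samples _ _ _ _ _ _ X X' muX Xiid indep i f).
  apply: (measurableT_comp (measurable_powR q)).
  apply: (@measurable_nn_dist _ _ N Nnorm _ ('rV[R]_d * sample_space X')%type
    k m fst (fun j z => X' j z.2) km) => // j.
  by apply: (measurableT_comp (mX' j)).
by move=> z; exact: powR_ge0.
Qed.

(** All [X i] have law [muX], so the [n] averaged costs have equal expectations and the bound is
    free of [n]. *)
Lemma expectation_wasserstein_le (q : R) (n k m : nat) :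
  0 < q -> (0 < n)%N -> (0 < k <= m)%N ->
  (\int[P]_w (wasserstein N q (empirical_measure n (fun i => X i w))
     (nn_measure N k n m (fun i => X i w) (fun j => X' j w)) `^ q)
   <= \int[muX]_x nn_moment N X' q k m x)%E.
Proof.
move=> q0 n0 /andP[k0 km].
have n0' : n%:R != 0 :> R by rewrite pnatr_eq0 -lt0n.
have mD i : measurable_fun setT (fun w => (nn_dist N k m (fun j => X' j w) (X i w) `^ q)%:E).
  apply/measurable_EFinP; apply: (measurableT_comp (measurable_powR q)).
  apply: (measurable_nn_dist N Nnorm k m (fun w => X i w) (fun j w => X' j w) km).
    exact: (@measurable_funP _ _ _ _ setT (X i)).
  by move=> j; exact: (@measurable_funP _ _ _ _ setT (X' j)).
have D0 i w : (0 <= (nn_dist N k m (fun j => X' j w) (X i w) `^ q)%:E)%E.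
  by rewrite lee_fin powR_ge0.
apply: (@le_trans _ _ (\int[P]_w ((n%:R^-1)%:E *
    \sum_(i < n) (nn_dist N k m (fun j => X' j w) (X i w) `^ q)%:E))%E).
  apply: ge0_le_integral_nonmeasurable => w; first exact: poweR_ge0.
  by apply: (wasserstein_nn_le N Nnorm q n k m (fun i => X i w) (fun j => X' j w)) => //; rewrite k0.
rewrite ge0_integralZl//; last 2 first.
- by apply: emeasurable_sum => i; exact: mD.
- by move=> w _; apply: sume_ge0.
rewrite ge0_integral_sum//.
(* The factor 1 lets the integral be pulled out of the sum, leaving a sum of ones that cancels
   [n^-1]. *)
rewrite (eq_bigr (fun=> 1%:E * \int[muX]_x nn_moment N X' q k m x)%E); last first.
  by move=> i _; have [_ ->] := integral_nn_dist q k m i km; rewrite mul1e.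
rewrite -ge0_sume_distrl//.
by rewrite sumEFin sumr_const card_ord muleA -EFinM mulVf// mul1e.
Qed.

End nn_moment_integral.

(** A form of the reverse Fatou lemma. The [phi m] need not converge, but [maxe (phi m) psi] is
    eventually equal to [psi] at each point of [U] and is dominated by [h + psi], so its integrals
    converge to that of [psi]. *)
Lemma limn_esup_integral_le {R : realType} {disp} {T : measurableType disp}
    (mu : {measure set T -> \bar R}) (U : set T) (a : (\bar R)^nat)
    (phi : nat -> T -> \bar R) (psi h : T -> \bar R) :
  measurable U -> mu (~` U) = 0%E ->
  (forall m x, (0 <= phi m x)%E) -> (forall x, (0 <= psi x)%E) ->
  mu.-integrable U psi -> mu.-integrable U h ->
  (\forall m \near \oo, measurable_fun setT (phi m)) ->
  (\forall m \near \oo, (a m <= \int[mu]_x phi m x)%E) ->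
  (\forall m \near \oo, forall x, U x -> (phi m x <= h x)%E) ->
  (forall x, U x -> \forall m \near \oo, (phi m x <= psi x)%E) ->
  (limn_esup a <= \int[mu]_(x in U) psi x)%E.
Proof.
move=> mU muU phi0 psi0 ipsi ih [m1 _ mphi] [m2 _ aphi] [m3 _ phih] phipsi.
pose m4 := (m1 + m2 + m3)%N.
have hm1 m : (m1 <= m + m4)%N by rewrite /m4; lia.
have hm2 m : (m4 <= m)%N -> (m2 <= m)%N by rewrite /m4; lia.
have hm3 m : (m3 <= m + m4)%N by rewrite /m4; lia.
(* The shift by [m4] makes the eventual hypotheses hold for every index, as dominated convergence
   requires. *)
pose g m x := maxe (phi (m + m4)%N x) (psi x).
have mg m : measurable_fun U (g m).
  apply: measurable_maxe; last exact: measurable_int ipsi.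
  by apply: measurable_funTS; apply: mphi; exact: hm1.
have [_ _ cvg_g] : [/\ mu.-integrable U psi,
    [sequence \int[mu]_(x in U) `|g n x - psi x|]_n @ \oo --> 0 &
    [sequence \int[mu]_(x in U) g n x]_n @ \oo --> \int[mu]_(x in U) psi x]%E.
  apply: (@dominated_convergence _ _ _ mu U mU g psi (h \+ psi)%E) => //.
  - exact: measurable_int ipsi.
  - apply/aeW => x Ux; apply: cvg_near_cst.
    have [m5 _ H] := phipsi x Ux; exists m5 => // m /= m5m.
    by apply/max_idPr; apply: H => /=; exact: leq_trans (leq_addr _ _).
  - exact: integrableD.
  - apply/aeW => x m Ux; rewrite gee0_abs; last by rewrite le_max phi0.
    have hx0 : (0 <= h x)%E by apply: le_trans (phih _ (hm3 0%N) x Ux).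
    rewrite ge_max leeDr// andbT; apply: (le_trans (phih _ (hm3 m) x Ux)).
    by rewrite leeDl.
have L_fin : (\int[mu]_(x in U) psi x)%E \is a fin_num by exact: integrable_fin_num.
apply/lee_addgt0Pr => e e0.
move: cvg_g; rewrite -(fineK L_fin) => /fine_cvgP[gfin /cvgrPdist_le/(_ _ e0) ge].
have [m5 _ Hm5] : \forall m \near \oo,
    (\int[mu]_(x in U) g m x <= (fine (\int[mu]_(x in U) psi x)%E + e)%:E)%E.
  apply: filterS2 gfin ge => m gm.
  rewrite /= ler_norml => /andP[gle _].
  move: gm gle; rewrite /= => gm gle; rewrite -(fineK gm) lee_fin; lra.
(* The upper limit is an infimum of suprema over neighbourhoods of infinity; one tail is enough. *)
apply: (@le_trans _ _ (ereal_sup (a @` [set m | (m4 + m5 <= m)%N]))).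
  by apply: ereal_inf_lbound; exists [set m | (m4 + m5 <= m)%N] => //; exists (m4 + m5)%N.
apply: ge_ereal_sup => _ [m /= mm <-]; rewrite -EFinD.
have m4m : (m4 <= m)%N by exact: leq_trans (leq_addr _ _) mm.
have m5m : (m5 <= m - m4)%N by rewrite leq_subRL.
apply: le_trans (aphi m (hm2 m m4m)) _.
apply: le_trans (Hm5 _ m5m).
have mphim : measurable_fun setT (phi m).
  by apply: mphi => /=; rewrite -(subnK m4m); exact: hm1.
rewrite (ge0_negligible_integral (measurableC mU) measurableT mphim)//.
rewrite setTD setCK; apply: ge0_le_integral => //.
- exact: measurable_funTS.
- by move=> x _; rewrite /g subnK// le_max lexx.
Qed.

Theorem corollary3p9 (R : realType) (d : nat) (q : R)
    (d_ge1 : (1 <= d)%N) (q_ge1 : 1 <= q) :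
  exists c : R, 1 < c /\
  forall (N : 'rV[R]_d -> R), is_norm N ->
  forall (muX muX' : probability 'rV[R]_d R)
    (disp : measure_display) (Omega : measurableType disp)
    (P : probability Omega R) (X X' : nat -> {RV P >-> 'rV[R]_d}),
  iid X muX -> iid X' muX' -> independent_samples X X' ->
  (exists m0 : nat, (1 <= m0)%N /\
    (\int[P]_w (\big[Order.min/+oo]_(j < m0) (N (X' j w))%:E) < +oo)%E) ->
  forall (U : set 'rV[R]_d) (pX' : 'rV[R]_d -> R),
  open U -> msupport N muX `<=` U ->
  density_on muX' U pX' ->
  {within U, continuous pX'} -> (forall x, U x -> 0 < pX' x) ->
  (exists kappa rkappa : R, [/\ 0 < kappa <= 1, 0 < rkappa &
    forall x r, U x -> 0 <= r <= rkappa ->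
      ((kappa * pX' x * unit_ball_volume N * r ^+ d)%:E
         <= muX' (norm_ball N x r))%E]) ->
  (\int[muX]_x ((1 + N x `^ q) / pX' x `^ (q / d%:R))%:E < +oo)%E ->
  forall k : nat -> nat,
  (forall m, (1 <= m)%N -> (1 <= k m <= m)%N) ->
  (forall m1 m2, (1 <= m1 <= m2)%N -> (k m1 <= k m2)%N) ->
  (k m)%:R / m%:R @[m --> \oo] --> (0 : R) ->
  forall n : nat, (1 <= n)%N ->
  (limn_esup (fun m : nat =>
     ((m%:R / (k m)%:R) `^ (q / d%:R))%:E *
     \int[P]_w (wasserstein N q
        (empirical_measure n (fun i => X i w))
        (nn_measure N (k m) n m (fun i => X i w) (fun j => X' j w)) `^ q))
   <= (c * (Gamma (1 + q / d%:R) / unit_ball_volume N `^ (q / d%:R)))%:E *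
      \int[muX]_x (1 / pX' x `^ (q / d%:R))%:E)%E.
Proof.
have q0 : 0 < q by exact: lt_le_trans q_ge1.
have dR0 : 0 < d%:R :> R by rewrite ltr0n.
have a0 : 0 <= q / d%:R by rewrite divr_ge0 ?ltW.
have G0 : 0 < Gamma (1 + q / d%:R) by apply: Gamma_gt0; rewrite lerDl.
have [C C0 HC] := nn_moment_eventually_le d q d_ge1 (ltW q0).
set a := q / d%:R in a0 G0 HC *; set G := Gamma _ in G0 *.
(* The 2 ensures [1 < c], and [C / G] ensures [C <= c * G]. *)
exists (2 + C / G); split; first by rewrite ltr_wpDr ?ltr1n// divr_ge0// ltW.
move=> N Nnorm muX muX' disp Omega P X X' Xiid X'iid indep [m0 [m00 minX']].
move=> U p oU suppU dens cp pU [kappa [rho [/andP[kappa0 _] rho0 ballF]]] momX.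
move=> k kP _ kcvg n n0.
have [M M0 tailM] := norm_tail_of_min_moment N X' muX' m0 Nnorm X'iid minX'.
have v0 := unit_ball_volume_gt0 Nnorm; set v := unit_ball_volume N in v0 *.
have va0 : 0 < v `^ a by rewrite powR_gt0.
have [mp p0 pE] := dens.
have mU : measurable U by exact: open_measurable_rV.
have muU : muX (~` U) = 0%E by exact: measure_setC_of_msupport Nnorm oU suppU.
have N0 := is_norm_ge0 Nnorm.
have mpa : measurable_fun setT (fun x => 1 / p x `^ a).
  apply: (eq_measurable_fun (fun x => p x `^ (- a))).
    by move=> x _; rewrite powRN div1r.
  by apply: (measurableT_comp (measurable_powR _)).
have mNq : measurable_fun setT (fun x => 1 + N x `^ q).
  apply: measurable_funD => //; apply: (measurableT_comp (measurable_powR _)).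
  exact: measurable_norm.
pose w x := 1 / p x `^ a.
pose W x := (1 + N x `^ q) / p x `^ a.
have w0 x : 0 <= w x by rewrite divr_ge0 ?powR_ge0.
have W0 x : 0 <= W x by rewrite divr_ge0 ?powR_ge0// addr_ge0 ?powR_ge0.
have WE x : W x = (1 + N x `^ q) * w x by rewrite /w div1r.
have mW : measurable_fun setT W.
  apply: (eq_measurable_fun (fun x => (1 + N x `^ q) * w x)).
    by move=> x _; rewrite WE.
  exact: measurable_funM.
have iW : muX.-integrable setT (EFin \o W).
  apply/integrableP; split; first exact/measurable_EFinP.
  rewrite (eq_integral (fun x => (W x)%:E)) => [//|x _].
  by rewrite /= ger0_norm.
have iw : muX.-integrable setT (EFin \o w).
  apply: le_integrable iW => //; first exact/measurable_EFinP.
  move=> x _; rewrite /= lee_fin !ger0_norm// WE ler_peMl//.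
  by rewrite lerDl powR_ge0.
pose psi x := ((C / v `^ a)%:E * (w x)%:E)%E.
have CV0 : 0 <= C / v `^ a by rewrite divr_ge0 ?ltW.
have [H1 [H2 [H10 H20 dom]]] := nn_moment_dominated q kappa rho M m0 N X' muX' k
  d_ge1 (ltW q0) kappa0 rho0 Nnorm X'iid m00 M0 tailM kP kcvg.
pose h x := (H1%:E * (W x)%:E + (cst H2%:E) x)%E.
have ih : muX.-integrable setT h.
  apply: integrableD => //; first exact: integrableZl.
  exact: finite_measure_integrable_cst.
have ipsi : muX.-integrable setT psi by exact: integrableZl.
pose phi m x := (((m%:R / (k m)%:R) `^ a)%:E * nn_moment N X' q (k m) m x)%E.
have nn0 k' m x : (0 <= nn_moment N X' q k' m x)%E.
  by apply: integral_ge0 => z _; rewrite lee_fin powR_ge0.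
have y0 m : (0 <= ((m%:R / (k m)%:R) `^ a)%:E)%E by rewrite lee_fin powR_ge0.
have phi0 m x : (0 <= phi m x)%E by rewrite mule_ge0.
have psi0 x : (0 <= psi x)%E by rewrite mule_ge0// lee_fin.
have m1 := nbhs_infty_ge 1.
apply: (@le_trans _ _ (\int[muX]_(x in U) psi x)%E).
  apply: (limn_esup_integral_le muX U _ phi psi h mU muU phi0 psi0).
  - exact: integrableS ipsi.
  - exact: integrableS ih.
  - apply: filterS m1 => m /kP/andP[_ km].
    (* The index 0 of the sample point is arbitrary: only the measurability of the moment in [x] is
       extracted. *)
    have [mm _] := integral_nn_dist N Nnorm X X' muX Xiid indep q (k m) m 0%N km.
    exact: emeasurable_funM.
  - apply: filterS m1 => m /kP kkm; have /andP[_ km] := kkm.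
    have [mm _] := integral_nn_dist N Nnorm X X' muX Xiid indep q (k m) m 0%N km.
    rewrite ge0_integralZl//; apply: lee_wpmul2l => //.
    exact: expectation_wasserstein_le.
  - apply: filterS dom => m Hm x Ux; apply: (Hm x (p x) (pU x Ux)).
    move=> r /andP[r0 rrho]; rewrite -/v.
    rewrite -lee_fin fineK ?fin_num_measure//; last exact: measurable_norm_ball.
    by apply: ballF => //; rewrite ltW.
  - move=> x Ux.
    have [rho' rho'0 near] := density_ball_lower_bound N muX' U p x Nnorm oU dens cp Ux (pU x Ux).
    have := HC N disp Omega P X' muX' m0 M k x (p x) rho' Nnorm X'iid m00 M0 tailM
      kP kcvg (pU x Ux) rho'0 near.
    apply: filterS => m Hm; apply: (le_trans Hm).
    rewrite /psi -EFinM lee_fin -/v /w powRM ?p0 ?(ltW v0)//.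
    rewrite le_eqVlt; apply/orP; left; apply/eqP.
    by field; rewrite !gt_eqF ?powR_gt0// pU.
apply: (@le_trans _ _ (\int[muX]_x psi x)%E).
  apply: ge0_subset_integral => //.
  by apply: measurable_int ipsi.
rewrite ge0_integralZl//; last 2 first.
- exact/measurable_EFinP.
- by move=> x _; rewrite lee_fin.
apply: lee_wpmul2r.
  by apply: integral_ge0 => x _; rewrite lee_fin.
(* After cancelling [v ^ a] the claim is [C <= 2 * G + C]. *)
rewrite lee_fin mulrA ler_pM2r ?invr_gt0// mulrDl divfK ?gt_eqF//.
by rewrite lerDr mulr_ge0// ltW.
Qed.
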